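(* Homotopy Type Theory with the addition of the law of excluded middle for h-propositions is impredicative, in the sense that classical second-order arithmetic $\mathbf{PA}^2$ can be interpreted in it.
   Context: Homotopy Type Theory (HoTT) is intensional Martin-Löf type theory with universes extended with the Univalence Axiom and higher inductive types (including propositional truncation and set quotients). A type $P$ is an h-proposition if $x=_P y$ holds for all $x,y:P$. The law of excluded middle for h-propositions postulates $\phi\lor\neg\phi$ for every h-proposition $\phi$, where $\lor$ is the propositional truncation of the disjoint sum. $\mathbf{PA}^2$ is classical second-order arithmetic: the language of $\mathbf{PA}$ with a second sort of variables $X,Y,\dots$ for sets of natural numbers and atomic formulas $t\in X$, with the second-order induction axiom and the full comprehension scheme. Equivalently, it can be formulated with set variables read as characteristic functions of type $\mathbf{N}\to\mathbf{N}$ and $t\in X$ read as $X(t)=1$, comprehension being $\exists f^{\mathbf{N}\to\mathbf{N}}\forall x^{\mathbf{N}}(fx=1\Leftrightarrow\phi(x))$ for arbitrary $\phi$ in which $f$ is not free. *)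

(* Defs.v *)
From Stdlib Require Import List.
Import ListNotations.

(** * Homotopy type theory with excluded middle for h-propositions

    The presentation is the constant-based one of the appendix of the HoTT
    Book: raw terms are built by abstraction, application, dependent products
    and universes from primitive constants; every other type former,
    constructor and eliminator is a constant.  Variables are de Bruijn indices,
    abstractions carry no domain, and conversion is defined on raw terms.
    Higher inductive types compute judgmentally on points and propositionally
    on paths.  The constant [cLEM] is the added principle; without it the system
    is plain homotopy type theory. *)

Inductive const : Set :=
| cEmpty | cIndEmpty
| cUnit | cStar | cIndUnit
| cSum | cInl | cInr | cIndSum
| cSig | cPair | cIndSig
| cNat | cZero | cSucc | cIndNat
| cW | cSup | cIndW
| cId | cRefl | cIndId
| cTrunc | cTruncIn | cTruncPath | cIndTrunc
| cSetQuot | cSetQuotIn | cSetQuotEq | cSetQuotSet | cIndSetQuot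
(* pushouts subsume the circle, suspensions and joins *)
| cPushout | cPushoutL | cPushoutR | cGlue | cIndPushout | cIndPushoutGlue
| cUnivalence (i : nat)
| cLEM.

Inductive term : Set :=
| Var (n : nat)
| U (i : nat)
| Pi (A B : term)          (* binds one variable in [B] *)
| Lam (t : term)           (* binds one variable in [t] *)
| App (f a : term)
| Cst (c : const).

Definition scons {T : Type} (x : T) (s : nat -> T) (n : nat) : T :=
  match n with 0 => x | S n => s n end.

Fixpoint ren (r : nat -> nat) (t : term) : term :=
  match t with
  | Var n => Var (r n)
  | U i => U i
  | Pi A B => Pi (ren r A) (ren (scons 0 (fun n => S (r n))) B)
  | Lam t => Lam (ren (scons 0 (fun n => S (r n))) t)
  | App f a => App (ren r f) (ren r a)
  | Cst c => Cst c
  end.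

Definition lift (t : term) : term := ren S t.

Definition up (s : nat -> term) : nat -> term :=
  scons (Var 0) (fun n => lift (s n)).

Fixpoint subst (s : nat -> term) (t : term) : term :=
  match t with
  | Var n => s n
  | U i => U i
  | Pi A B => Pi (subst s A) (subst (up s) B)
  | Lam t => Lam (subst (up s) t)
  | App f a => App (subst s f) (subst s a)
  | Cst c => Cst c
  end.

Definition subst1 (a t : term) : term := subst (scons a Var) t.

Definition apps (f : term) (l : list term) : term := fold_left App l f.

(** ** Readable syntax for closed terms

    A term scheme [b : bterm] maps a binding depth [d] to a raw term whose free
    variables are the [d] enclosing binders.  The variable bound at depth [d]
    has index [d' - S d] when it is used at depth [d'], so Rocq binders can be
    used to write object-level ones. *)

Definition bterm : Set := nat -> term.

Definition bU (i : nat) : bterm := fun _ => U i.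
Definition bcst (c : const) : bterm := fun _ => Cst c.
Definition bapp (f a : bterm) : bterm := fun d => App (f d) (a d).
Definition bpi (A : bterm) (B : bterm -> bterm) : bterm :=
  fun d => Pi (A d) (B (fun d' => Var (d' - S d)) (S d)).
Definition blam (t : bterm -> bterm) : bterm :=
  fun d => Lam (t (fun d' => Var (d' - S d)) (S d)).

Definition close (b : bterm) : term := b 0.

Declare Scope bterm_scope.
Delimit Scope bterm_scope with B.
Bind Scope bterm_scope with bterm.
Coercion bcst : const >-> bterm.

Notation "'Π' x : A , B" := (bpi A (fun x => B))
  (at level 200, x name, A at level 99, B at level 200, right associativity)
  : bterm_scope.
Notation "'λ' x , t" := (blam (fun x => t))
  (at level 200, x name, t at level 200, right associativity) : bterm_scope.
Notation "A ⇒ B" := (bpi A (fun _ => B))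
  (at level 99, B at level 200, right associativity) : bterm_scope.
Notation "f · a" := (bapp f a) (at level 40, left associativity) : bterm_scope.

Section DerivedNotions.
Local Open Scope bterm_scope.

Definition bprod (A B : bterm) : bterm := cSig · A · (λ _x, B).
Definition bnot (A : bterm) : bterm := A ⇒ cEmpty.

Definition bisProp (A : bterm) : bterm := Π x : A, Π y : A, cId · A · x · y.
Definition bisSet (A : bterm) : bterm :=
  Π x : A, Π y : A, bisProp (cId · A · x · y).

Definition btransport (A P x y p u : bterm) : bterm :=
  cIndId · A · (λ x', λ y', λ _p, P · x' ⇒ P · y')
         · (λ _x, λ v, v) · x · y · p · u.

Definition bapd (A P f x y p : bterm) : bterm :=
  cIndId · A
    · (λ x', λ y', λ p',
         cId · (P · y') · btransport A P x' y' p' (f · x') · (f · y'))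
    · (λ x', cRefl · (P · x') · (f · x'))
    · x · y · p.

Definition bisEquiv (A B f : bterm) : bterm :=
  bprod (cSig · (B ⇒ A) · (λ g, Π y : B, cId · B · (f · (g · y)) · y))
        (cSig · (B ⇒ A) · (λ h, Π x : A, cId · A · (h · (f · x)) · x)).

Definition bEquiv (A B : bterm) : bterm :=
  cSig · (A ⇒ B) · (λ f, bisEquiv A B f).

Definition bidEquiv (A : bterm) : bterm :=
  let idfun := λ x, x in
  let inverse :=
    cPair · (A ⇒ A) · (λ g, Π x : A, cId · A · (g · x) · x)
          · idfun · (λ x, cRefl · A · x) in
  cPair · (A ⇒ A) · (λ f, bisEquiv A A f) · idfun
    · (cPair · (cSig · (A ⇒ A) · (λ g, Π y : A, cId · A · (idfun · (g · y)) · y))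
             · (λ _x, cSig · (A ⇒ A)
                           · (λ h, Π x : A, cId · A · (h · (idfun · x)) · x))
             · inverse · inverse).

Definition bidtoeqv (i : nat) (A B p : bterm) : bterm :=
  cIndId · bU i · (λ A', λ B', λ _p, bEquiv A' B') · (λ A', bidEquiv A')
         · A · B · p.

(** [constType c i j] is the type of [c].  Universe levels are typically
    ambiguous: [i] is the level of the types a constant is applied to, and [j]
    that of the motive of an eliminator; both are arbitrary. *)
Definition constType (c : const) (i j : nat) : bterm :=
  match c with
  | cEmpty => bU i
  | cIndEmpty => Π P : cEmpty ⇒ bU j, Π x : cEmpty, P · x

  | cUnit => bU i
  | cStar => cUnit
  | cIndUnit => Π P : cUnit ⇒ bU j, P · cStar ⇒ Π x : cUnit, P · x

  | cSum => bU i ⇒ bU i ⇒ bU i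
  | cInl => Π A : bU i, Π B : bU i, A ⇒ cSum · A · B
  | cInr => Π A : bU i, Π B : bU i, B ⇒ cSum · A · B
  | cIndSum =>
      Π A : bU i, Π B : bU i, Π P : cSum · A · B ⇒ bU j,
      (Π a : A, P · (cInl · A · B · a)) ⇒
      (Π b : B, P · (cInr · A · B · b)) ⇒
      Π x : cSum · A · B, P · x

  | cSig => Π A : bU i, (A ⇒ bU i) ⇒ bU i
  | cPair =>
      Π A : bU i, Π B : A ⇒ bU i, Π a : A, B · a ⇒ cSig · A · B
  | cIndSig =>
      Π A : bU i, Π B : A ⇒ bU i, Π P : cSig · A · B ⇒ bU j,
      (Π a : A, Π b : B · a, P · (cPair · A · B · a · b)) ⇒
      Π x : cSig · A · B, P · x

  | cNat => bU i
  | cZero => cNat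
  | cSucc => cNat ⇒ cNat
  | cIndNat =>
      Π P : cNat ⇒ bU j, P · cZero ⇒
      (Π n : cNat, P · n ⇒ P · (cSucc · n)) ⇒
      Π n : cNat, P · n

  | cW => Π A : bU i, (A ⇒ bU i) ⇒ bU i
  | cSup =>
      Π A : bU i, Π B : A ⇒ bU i, Π a : A, (B · a ⇒ cW · A · B) ⇒ cW · A · B
  | cIndW =>
      Π A : bU i, Π B : A ⇒ bU i, Π P : cW · A · B ⇒ bU j,
      (Π a : A, Π f : B · a ⇒ cW · A · B,
         (Π b : B · a, P · (f · b)) ⇒ P · (cSup · A · B · a · f)) ⇒
      Π x : cW · A · B, P · x

  | cId => Π A : bU i, A ⇒ A ⇒ bU i
  | cRefl => Π A : bU i, Π x : A, cId · A · x · x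
  | cIndId =>
      Π A : bU i, Π P : (Π x : A, Π y : A, cId · A · x · y ⇒ bU j),
      (Π x : A, P · x · x · (cRefl · A · x)) ⇒
      Π x : A, Π y : A, Π p : cId · A · x · y, P · x · y · p

  | cTrunc => bU i ⇒ bU i
  | cTruncIn => Π A : bU i, A ⇒ cTrunc · A
  | cTruncPath => Π A : bU i, bisProp (cTrunc · A)
  | cIndTrunc =>
      Π A : bU i, Π P : cTrunc · A ⇒ bU j,
      (Π x : cTrunc · A, bisProp (P · x)) ⇒
      (Π a : A, P · (cTruncIn · A · a)) ⇒
      Π x : cTrunc · A, P · x

  | cSetQuot => Π A : bU i, (A ⇒ A ⇒ bU i) ⇒ bU i
  | cSetQuotIn => Π A : bU i, Π R : A ⇒ A ⇒ bU i, A ⇒ cSetQuot · A · R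
  | cSetQuotEq =>
      Π A : bU i, Π R : A ⇒ A ⇒ bU i, Π a : A, Π b : A, R · a · b ⇒
      cId · (cSetQuot · A · R) · (cSetQuotIn · A · R · a) · (cSetQuotIn · A · R · b)
  | cSetQuotSet => Π A : bU i, Π R : A ⇒ A ⇒ bU i, bisSet (cSetQuot · A · R)
  | cIndSetQuot =>
      Π A : bU i, Π R : A ⇒ A ⇒ bU i, Π P : cSetQuot · A · R ⇒ bU j,
      (Π x : cSetQuot · A · R, bisSet (P · x)) ⇒
      Π f : (Π a : A, P · (cSetQuotIn · A · R · a)),
      (Π a : A, Π b : A, Π r : R · a · b,
         cId · (P · (cSetQuotIn · A · R · b))
             · btransport (cSetQuot · A · R) P
                 (cSetQuotIn · A · R · a) (cSetQuotIn · A · R · b)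
                 (cSetQuotEq · A · R · a · b · r) (f · a)
             · (f · b)) ⇒
      Π x : cSetQuot · A · R, P · x

  | cPushout =>
      Π A : bU i, Π B : bU i, Π C : bU i, (C ⇒ A) ⇒ (C ⇒ B) ⇒ bU i
  | cPushoutL =>
      Π A : bU i, Π B : bU i, Π C : bU i, Π f : C ⇒ A, Π g : C ⇒ B,
      A ⇒ cPushout · A · B · C · f · g
  | cPushoutR =>
      Π A : bU i, Π B : bU i, Π C : bU i, Π f : C ⇒ A, Π g : C ⇒ B,
      B ⇒ cPushout · A · B · C · f · g
  | cGlue =>
      Π A : bU i, Π B : bU i, Π C : bU i, Π f : C ⇒ A, Π g : C ⇒ B,
      Π c : C,
      cId · (cPushout · A · B · C · f · g)
          · (cPushoutL · A · B · C · f · g · (f · c))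
          · (cPushoutR · A · B · C · f · g · (g · c))
  | cIndPushout =>
      Π A : bU i, Π B : bU i, Π C : bU i, Π f : C ⇒ A, Π g : C ⇒ B,
      Π P : cPushout · A · B · C · f · g ⇒ bU j,
      Π l : (Π a : A, P · (cPushoutL · A · B · C · f · g · a)),
      Π r : (Π b : B, P · (cPushoutR · A · B · C · f · g · b)),
      (Π c : C,
         cId · (P · (cPushoutR · A · B · C · f · g · (g · c)))
             · btransport (cPushout · A · B · C · f · g) P
                 (cPushoutL · A · B · C · f · g · (f · c))
                 (cPushoutR · A · B · C · f · g · (g · c))
                 (cGlue · A · B · C · f · g · c) (l · (f · c))
             · (r · (g · c))) ⇒
      Π x : cPushout · A · B · C · f · g, P · x
  | cIndPushoutGlue =>
      Π A : bU i, Π B : bU i, Π C : bU i, Π f : C ⇒ A, Π g : C ⇒ B,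
      Π P : cPushout · A · B · C · f · g ⇒ bU j,
      Π l : (Π a : A, P · (cPushoutL · A · B · C · f · g · a)),
      Π r : (Π b : B, P · (cPushoutR · A · B · C · f · g · b)),
      Π h : (Π c : C,
         cId · (P · (cPushoutR · A · B · C · f · g · (g · c)))
             · btransport (cPushout · A · B · C · f · g) P
                 (cPushoutL · A · B · C · f · g · (f · c))
                 (cPushoutR · A · B · C · f · g · (g · c))
                 (cGlue · A · B · C · f · g · c) (l · (f · c))
             · (r · (g · c))),
      Π c : C,
      cId · (cId · (P · (cPushoutR · A · B · C · f · g · (g · c)))
                 · btransport (cPushout · A · B · C · f · g) P
                     (cPushoutL · A · B · C · f · g · (f · c))
                     (cPushoutR · A · B · C · f · g · (g · c))
                     (cGlue · A · B · C · f · g · c) (l · (f · c))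
                 · (r · (g · c)))
          · bapd (cPushout · A · B · C · f · g) P
              (cIndPushout · A · B · C · f · g · P · l · r · h)
              (cPushoutL · A · B · C · f · g · (f · c))
              (cPushoutR · A · B · C · f · g · (g · c))
              (cGlue · A · B · C · f · g · c)
          · (h · c)

  (* the level is part of the constant because its type mentions [U k] as an
     argument of the identity type *)
  | cUnivalence k =>
      Π A : bU k, Π B : bU k,
      bisEquiv (cId · bU k · A · B) (bEquiv A B) (λ p, bidtoeqv k A B p)

  | cLEM => Π P : bU i, bisProp P ⇒ cTrunc · (cSum · P · bnot P)
  end.

End DerivedNotions.

Inductive compRule : term -> term -> Prop :=
| comp_beta t a : compRule (App (Lam t) a) (subst1 a t)
| comp_eta f : compRule (Lam (App (lift f) (Var 0))) f
| comp_unit P e :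
    compRule (apps (Cst cIndUnit) [P; e; Cst cStar]) e
| comp_inl A B P l r a :
    compRule (apps (Cst cIndSum) [A; B; P; l; r; apps (Cst cInl) [A; B; a]])
             (App l a)
| comp_inr A B P l r b :
    compRule (apps (Cst cIndSum) [A; B; P; l; r; apps (Cst cInr) [A; B; b]])
             (App r b)
| comp_pair A B P e a b :
    compRule (apps (Cst cIndSig) [A; B; P; e; apps (Cst cPair) [A; B; a; b]])
             (apps e [a; b])
| comp_zero P z s :
    compRule (apps (Cst cIndNat) [P; z; s; Cst cZero]) z
| comp_succ P z s n :
    compRule (apps (Cst cIndNat) [P; z; s; App (Cst cSucc) n])
             (apps s [n; apps (Cst cIndNat) [P; z; s; n]])
| comp_sup A B P e a f :
    compRule (apps (Cst cIndW) [A; B; P; e; apps (Cst cSup) [A; B; a; f]])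
             (apps e [a; f;
                Lam (apps (Cst cIndW) [lift A; lift B; lift P; lift e;
                                       App (lift f) (Var 0)])])
| comp_refl A P e x :
    compRule (apps (Cst cIndId) [A; P; e; x; x; apps (Cst cRefl) [A; x]])
             (App e x)
| comp_trunc A P h e a :
    compRule (apps (Cst cIndTrunc) [A; P; h; e; apps (Cst cTruncIn) [A; a]])
             (App e a)
| comp_quot A R P h e k a :
    compRule (apps (Cst cIndSetQuot) [A; R; P; h; e; k; apps (Cst cSetQuotIn) [A; R; a]])
             (App e a)
| comp_pushl A B C f g P l r h a :
    compRule (apps (Cst cIndPushout) [A; B; C; f; g; P; l; r; h;
                                   apps (Cst cPushoutL) [A; B; C; f; g; a]])
             (App l a)
| comp_pushr A B C f g P l r h b :
    compRule (apps (Cst cIndPushout) [A; B; C; f; g; P; l; r; h;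
                                   apps (Cst cPushoutR) [A; B; C; f; g; b]])
             (App r b).

Inductive conv : term -> term -> Prop :=
| conv_comp t u : compRule t u -> conv t u
| conv_refl t : conv t t
| conv_sym t u : conv t u -> conv u t
| conv_trans t u v : conv t u -> conv u v -> conv t v
| conv_Pi A A' B B' : conv A A' -> conv B B' -> conv (Pi A B) (Pi A' B')
| conv_Lam t t' : conv t t' -> conv (Lam t) (Lam t')
| conv_App f f' a a' : conv f f' -> conv a a' -> conv (App f a) (App f' a').

(* the most recently declared variable comes first *)
Definition ctx : Set := list term.

Inductive wfCtx : ctx -> Prop :=
| wf_nil : wfCtx []
| wf_cons G A i : wfCtx G -> hasType G A (U i) -> wfCtx (A :: G)

with hasType : ctx -> term -> term -> Prop :=
| ty_Var G n A :
    wfCtx G -> nth_error G n = Some A ->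
    hasType G (Var n) (ren (Nat.add (S n)) A)
| ty_Cst G c i j :
    wfCtx G -> hasType G (Cst c) (close (constType c i j))
| ty_U G i :
    wfCtx G -> hasType G (U i) (U (S i))
| ty_cumul G A i :
    hasType G A (U i) -> hasType G A (U (S i))
| ty_Pi G A B i :
    hasType G A (U i) -> hasType (A :: G) B (U i) -> hasType G (Pi A B) (U i)
| ty_Lam G A B t i :
    hasType G A (U i) -> hasType (A :: G) t B -> hasType G (Lam t) (Pi A B)
| ty_App G A B f a :
    hasType G f (Pi A B) -> hasType G a A -> hasType G (App f a) (subst1 a B)
| ty_conv G t A B i :
    hasType G t A -> hasType G B (U i) -> conv A B -> hasType G t B.

(* a raw term is a scheme once it is weakened to the binding depth of its use *)
Definition isProp (A : term) : term := close (bisProp (fun d => ren (Nat.add d) A)).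

(** * Classical second-order arithmetic

    Number variables and set variables are de Bruijn indices of two separate
    sorts; [FAll1], [FEx1] bind a number variable and [FAll2], [FEx2] a set
    variable. *)

Inductive tm : Set :=
| TVar (n : nat)
| TZero
| TSucc (t : tm)
| TAdd (t u : tm)
| TMul (t u : tm).

Inductive form : Set :=
| FEq (t u : tm)
| FMem (t : tm) (X : nat)
| FBot
| FAnd (p q : form)
| FOr (p q : form)
| FImp (p q : form)
| FAll1 (p : form)
| FEx1 (p : form)
| FAll2 (p : form)
| FEx2 (p : form).

Definition FNot (p : form) : form := FImp p FBot.
Definition FIff (p q : form) : form := FAnd (FImp p q) (FImp q p).

Fixpoint tsub (s : nat -> tm) (t : tm) : tm :=
  match t with
  | TVar n => s n
  | TZero => TZero
  | TSucc t => TSucc (tsub s t)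
  | TAdd t u => TAdd (tsub s t) (tsub s u)
  | TMul t u => TMul (tsub s t) (tsub s u)
  end.

Definition tup (s : nat -> tm) : nat -> tm :=
  scons (TVar 0) (fun n => tsub (fun m => TVar (S m)) (s n)).

(* [s] substitutes terms for number variables, [r] renames set variables *)
Fixpoint fsub (s : nat -> tm) (r : nat -> nat) (p : form) : form :=
  match p with
  | FEq t u => FEq (tsub s t) (tsub s u)
  | FMem t X => FMem (tsub s t) (r X)
  | FBot => FBot
  | FAnd p q => FAnd (fsub s r p) (fsub s r q)
  | FOr p q => FOr (fsub s r p) (fsub s r q)
  | FImp p q => FImp (fsub s r p) (fsub s r q)
  | FAll1 p => FAll1 (fsub (tup s) r p)
  | FEx1 p => FEx1 (fsub (tup s) r p)
  | FAll2 p => FAll2 (fsub s (scons 0 (fun n => S (r n))) p)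
  | FEx2 p => FEx2 (fsub s (scons 0 (fun n => S (r n))) p)
  end.

Definition shift1 (p : form) : form := fsub (fun n => TVar (S n)) (fun n => n) p.
Definition shift2 (p : form) : form := fsub TVar S p.
Definition inst1 (t : tm) (p : form) : form :=
  fsub (scons t TVar) (fun n => n) p.
Definition inst2 (X : nat) (p : form) : form :=
  fsub TVar (scons X (fun n => n)) p.

Inductive PA2axiom : form -> Prop :=
| ax_succ_nonzero :
    PA2axiom (FAll1 (FNot (FEq (TSucc (TVar 0)) TZero)))
| ax_succ_inj :
    PA2axiom (FAll1 (FAll1 (FImp (FEq (TSucc (TVar 1)) (TSucc (TVar 0)))
                                 (FEq (TVar 1) (TVar 0)))))
| ax_add_zero :
    PA2axiom (FAll1 (FEq (TAdd (TVar 0) TZero) (TVar 0)))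
| ax_add_succ :
    PA2axiom (FAll1 (FAll1 (FEq (TAdd (TVar 1) (TSucc (TVar 0)))
                                (TSucc (TAdd (TVar 1) (TVar 0))))))
| ax_mul_zero :
    PA2axiom (FAll1 (FEq (TMul (TVar 0) TZero) TZero))
| ax_mul_succ :
    PA2axiom (FAll1 (FAll1 (FEq (TMul (TVar 1) (TSucc (TVar 0)))
                                (TAdd (TMul (TVar 1) (TVar 0)) (TVar 1)))))
| ax_induction :
    PA2axiom (FAll2 (FImp (FAnd (FMem TZero 0)
                                (FAll1 (FImp (FMem (TVar 0) 0)
                                             (FMem (TSucc (TVar 0)) 0))))
                          (FAll1 (FMem (TVar 0) 0))))
(* number variable 0 of [p] is the element, all other variables of [p] are
   parameters; [shift2] makes the new set variable not free in [p] *)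
| ax_comprehension p :
    PA2axiom (FEx2 (FAll1 (FIff (FMem (TVar 0) 0) (shift2 p)))).

(* classical two-sorted natural deduction with equality *)
Inductive PA2derives : list form -> form -> Prop :=
| d_axiom H p : PA2axiom p -> PA2derives H p
| d_hyp H p : In p H -> PA2derives H p
| d_raa H p : PA2derives (FNot p :: H) FBot -> PA2derives H p
| d_impI H p q : PA2derives (p :: H) q -> PA2derives H (FImp p q)
| d_impE H p q : PA2derives H (FImp p q) -> PA2derives H p -> PA2derives H q
| d_andI H p q : PA2derives H p -> PA2derives H q -> PA2derives H (FAnd p q)
| d_andE1 H p q : PA2derives H (FAnd p q) -> PA2derives H p
| d_andE2 H p q : PA2derives H (FAnd p q) -> PA2derives H q
| d_orI1 H p q : PA2derives H p -> PA2derives H (FOr p q)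
| d_orI2 H p q : PA2derives H q -> PA2derives H (FOr p q)
| d_orE H p q r :
    PA2derives H (FOr p q) -> PA2derives (p :: H) r -> PA2derives (q :: H) r ->
    PA2derives H r
| d_all1I H p : PA2derives (map shift1 H) p -> PA2derives H (FAll1 p)
| d_all1E H p t : PA2derives H (FAll1 p) -> PA2derives H (inst1 t p)
| d_ex1I H p t : PA2derives H (inst1 t p) -> PA2derives H (FEx1 p)
| d_ex1E H p q :
    PA2derives H (FEx1 p) -> PA2derives (p :: map shift1 H) (shift1 q) ->
    PA2derives H q
| d_all2I H p : PA2derives (map shift2 H) p -> PA2derives H (FAll2 p)
| d_all2E H p X : PA2derives H (FAll2 p) -> PA2derives H (inst2 X p)
| d_ex2I H p X : PA2derives H (inst2 X p) -> PA2derives H (FEx2 p)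
| d_ex2E H p q :
    PA2derives H (FEx2 p) -> PA2derives (p :: map shift2 H) (shift2 q) ->
    PA2derives H q
| d_eqI H t : PA2derives H (FEq t t)
| d_eqE H p t u :
    PA2derives H (FEq t u) -> PA2derives H (inst1 t p) ->
    PA2derives H (inst1 u p).

Fixpoint tmScoped (m : nat) (t : tm) : Prop :=
  match t with
  | TVar n => n < m
  | TZero => True
  | TSucc t => tmScoped m t
  | TAdd t u | TMul t u => tmScoped m t /\ tmScoped m u
  end.

(* at most [m] free number variables and [k] free set variables *)
Fixpoint formScoped (m k : nat) (p : form) : Prop :=
  match p with
  | FEq t u => tmScoped m t /\ tmScoped m u
  | FMem t X => tmScoped m t /\ X < k
  | FBot => True
  | FAnd p q | FOr p q | FImp p q => formScoped m k p /\ formScoped m k q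
  | FAll1 p | FEx1 p => formScoped (S m) k p
  | FAll2 p | FEx2 p => formScoped m (S k) p
  end.

Definition sentence (p : form) : Prop := formScoped 0 0 p.

(** * The interpretation

    Formulas become h-propositions: numbers range over [cNat], sets over
    functions [cNat ⇒ cNat] read as characteristic functions, and disjunction
    and existence are truncated. *)

Section Interpretation.
Local Open Scope bterm_scope.

Definition badd (m n : bterm) : bterm :=
  cIndNat · (λ _n, cNat) · m · (λ _n, λ r, cSucc · r) · n.
Definition bmul (m n : bterm) : bterm :=
  cIndNat · (λ _n, cNat) · cZero · (λ _n, λ r, badd r m) · n.

Fixpoint interpTm (e : nat -> bterm) (t : tm) : bterm :=
  match t with
  | TVar n => e n
  | TZero => cZero
  | TSucc t => cSucc · interpTm e t
  | TAdd t u => badd (interpTm e t) (interpTm e u)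
  | TMul t u => bmul (interpTm e t) (interpTm e u)
  end.

Fixpoint interpForm (e s : nat -> bterm) (p : form) : bterm :=
  match p with
  | FEq t u => cId · cNat · interpTm e t · interpTm e u
  | FMem t X => cId · cNat · (s X · interpTm e t) · (cSucc · cZero)
  | FBot => cEmpty
  | FAnd p q => bprod (interpForm e s p) (interpForm e s q)
  | FOr p q => cTrunc · (cSum · interpForm e s p · interpForm e s q)
  | FImp p q => interpForm e s p ⇒ interpForm e s q
  | FAll1 p => Π x : cNat, interpForm (scons x e) s p
  | FEx1 p => cTrunc · (cSig · cNat · (λ x, interpForm (scons x e) s p))
  | FAll2 p => Π X : cNat ⇒ cNat, interpForm e (scons X s) p
  | FEx2 p =>
      cTrunc · (cSig · (cNat ⇒ cNat) · (λ X, interpForm e (scons X s) p))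
  end.

End Interpretation.

(* the environments are irrelevant for a sentence *)
Definition interp (p : form) : term :=
  close (interpForm (fun _ => bcst cZero) (fun _ => blam (fun _ => bcst cZero)) p).

(* Main.v *)
(* Formulas are interpreted as h-propositions of [U 0], sets of numbers being
   functions [cNat ⇒ cNat].  Logical rules are sound because truncated
   disjunctions and existentials eliminate into propositions, and propositions
   are closed under products by function extensionality, which follows from the
   interval, a pushout.  Impredicativity comes from excluded middle: for a
   predicate [P] valued in propositions [P n + not P n] is itself a proposition,
   hence can be extracted from its truncation, and a case distinction on it
   defines a characteristic function of [P], however complex [P] is.

   Soundness is a forcing-style induction: a sequent is valid when, in every
   context and for every pair of typed environments, inhabitants of the
   hypotheses yield an inhabitant of the conclusion.  The finitely many closed
   terms of type theory that this needs are accepted by a type checker which is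
   proved sound for [hasType] and run by computation. *)

Require Import Defs.
From Stdlib Require Import List Arith Lia.
Import ListNotations.

(** * Renaming and substitution *)

Lemma ren_ext t r r' : (forall n, r n = r' n) -> ren r t = ren r' t.
Proof.
  revert r r'; induction t; intros r r' E; simpl; f_equal; auto;
    match goal with IH : forall r r', _ -> _ = _ |- _ => apply IH end;
    intros [|n]; simpl; congruence.
Qed.

Lemma subst_ext t s s' : (forall n, s n = s' n) -> subst s t = subst s' t.
Proof.
  revert s s'; induction t; intros s s' E; simpl; f_equal; auto;
    match goal with IH : forall s s', _ -> _ = _ |- _ => apply IH end;
    intros [|n]; unfold up; simpl; congruence.
Qed.

Lemma ren_as_subst t r : ren r t = subst (fun n => Var (r n)) t.
Proof.
  revert r; induction t; intros r; simpl; f_equal; auto;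
    match goal with IH : forall r, _ = _ |- _ => rewrite IH end;
    apply subst_ext; intros [|n]; reflexivity.
Qed.

Lemma subst_Var t : subst Var t = t.
Proof.
  induction t; simpl; f_equal; auto;
    match goal with IH : _ = ?t |- _ = ?t => etransitivity; [|exact IH] end;
    apply subst_ext; intros [|n]; reflexivity.
Qed.

Lemma subst_ren t r s : subst s (ren r t) = subst (fun n => s (r n)) t.
Proof.
  revert r s; induction t; intros r s; simpl; f_equal; auto;
    match goal with IH : forall r s, _ = _ |- _ => rewrite IH end;
    apply subst_ext; intros [|n]; reflexivity.
Qed.

Lemma ren_ren t r r' : ren r (ren r' t) = ren (fun n => r (r' n)) t.
Proof. rewrite (ren_as_subst _ r), subst_ren; symmetry; apply ren_as_subst. Qed.

Lemma ren_subst t r s : ren r (subst s t) = subst (fun n => ren r (s n)) t.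
Proof.
  revert r s; induction t; intros r s; simpl; f_equal; auto;
    match goal with IH : forall r s, _ = _ |- _ => rewrite IH end;
    apply subst_ext; intros [|n]; unfold up, lift; simpl; auto;
    rewrite !ren_ren; reflexivity.
Qed.

Lemma subst_subst t s s' : subst s (subst s' t) = subst (fun n => subst s (s' n)) t.
Proof.
  revert s s'; induction t; intros s s'; simpl; f_equal; auto;
    match goal with IH : forall s s', _ = _ |- _ => rewrite IH end;
    apply subst_ext; intros [|n]; unfold up, lift; simpl; auto;
    rewrite subst_ren, ren_subst; reflexivity.
Qed.

Lemma subst_lift s t : subst (up s) (lift t) = lift (subst s t).
Proof. unfold lift; rewrite subst_ren, ren_subst; reflexivity. Qed.

Lemma ren_lift r t : ren (scons 0 (fun n => S (r n))) (lift t) = lift (ren r t).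
Proof. unfold lift; rewrite !ren_ren; reflexivity. Qed.

Lemma subst1_lift a t : subst1 a (lift t) = t.
Proof. unfold subst1, lift; rewrite subst_ren; apply subst_Var. Qed.

Lemma subst1_up a s t : subst1 a (subst (up s) t) = subst (scons a s) t.
Proof.
  unfold subst1; rewrite subst_subst; apply subst_ext.
  intros [|n]; [reflexivity | apply subst1_lift].
Qed.

Lemma ren_subst1 r a t :
  ren r (subst1 a t) = subst1 (ren r a) (ren (scons 0 (fun n => S (r n))) t).
Proof.
  unfold subst1; rewrite ren_subst, subst_ren; apply subst_ext.
  intros [|n]; reflexivity.
Qed.

(** * Weakening *)

Lemma compRule_ren r t u : compRule t u -> compRule (ren r t) (ren r u).
Proof.
  destruct 1; simpl; rewrite ?ren_subst1, ?ren_lift; constructor.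
Qed.

Lemma conv_ren r t u : conv t u -> conv (ren r t) (ren r u).
Proof.
  intros H; revert r; induction H; intros r; simpl.
  - apply conv_comp, compRule_ren; assumption.
  - apply conv_refl.
  - apply conv_sym; auto.
  - eapply conv_trans; eauto.
  - apply conv_Pi; auto.
  - apply conv_Lam; auto.
  - apply conv_App; auto.
Qed.

Lemma ren_constType r c i j :
  ren r (close (constType c i j)) = close (constType c i j).
Proof. destruct c; reflexivity. Qed.

(** Each type in a context lives over its own tail, so types at corresponding positions are compared
    only after weakening to the full contexts. *)
Definition renOk (r : nat -> nat) (G D : ctx) : Prop :=
  forall n A, nth_error G n = Some A ->
    exists A', nth_error D (r n) = Some A' /\
      ren (Nat.add (S (r n))) A' = ren r (ren (Nat.add (S n)) A).

Lemma renOk_cons r G D A :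
  renOk r G D -> renOk (scons 0 (fun n => S (r n))) (A :: G) (ren r A :: D).
Proof.
  intros Hr [|n] B E; simpl in *.
  - injection E as <-; eexists; split; [reflexivity|]; rewrite !ren_ren; reflexivity.
  - destruct (Hr n B E) as (B' & E' & H); exists B'; split; [exact E'|].
    apply (f_equal lift) in H; unfold lift in H; rewrite !ren_ren in H.
    rewrite !ren_ren; exact H.
Qed.

(** Weakening is proved for arbitrary renamings, so that the induction passes under binders by
    [renOk_cons]. The target context is assumed well formed because the rules for variables,
    constants and universes ask for it. *)
Lemma hasType_ren G t T :
  hasType G t T -> forall D r, wfCtx D -> renOk r G D ->
  hasType D (ren r t) (ren r T).
Proof.
  induction 1; intros D r HD Hr; cbn [ren].
  - destruct (Hr _ _ H0) as (A' & E & <-); constructor; assumption.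
  - rewrite ren_constType; constructor; assumption.
  - constructor; assumption.
  - apply ty_cumul, IHhasType; assumption.
  - specialize (IHhasType1 D r HD Hr).
    apply ty_Pi; [exact IHhasType1|].
    apply IHhasType2; [econstructor; eassumption | apply renOk_cons, Hr].
  - specialize (IHhasType1 D r HD Hr).
    eapply ty_Lam; [exact IHhasType1|].
    apply IHhasType2; [econstructor; eassumption | apply renOk_cons, Hr].
  - rewrite ren_subst1; eapply ty_App; [apply (IHhasType1 D r HD Hr) | auto].
  - eapply ty_conv; [apply IHhasType1 | apply (IHhasType2 D r) |]; auto.
    apply conv_ren; assumption.
Qed.

Lemma hasType_lift G A t T :
  wfCtx (A :: G) -> hasType G t T -> hasType (A :: G) (lift t) (lift T).
Proof.
  intros W H; apply (hasType_ren _ _ _ H _ _ W).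
  intros n B E; exists B; split; [exact E|]; rewrite ren_ren; reflexivity.
Qed.

Definition inh (G : ctx) (A : term) : Prop := exists t, hasType G t A.

(** Renaming a closed derivation is vacuous. The trivial substitution [subst Var] is kept because it
    starts the chain of instantiations by [inh_inst]. *)
Lemma inh_closed G T : inh [] T -> wfCtx G -> inh G (subst Var T).
Proof.
  intros [t H] W; change (inh G (subst (fun n => Var (id n)) T)).
  rewrite <- ren_as_subst; exists (ren id t).
  apply (hasType_ren _ _ _ H _ _ W); intros [|n] A E; discriminate.
Qed.

(* Delaying the substitution keeps the type of a repeatedly instantiated closed
   lemma in a form that computes. *)
Lemma hasType_inst G s t A B a :
  hasType G t (subst s (Pi A B)) -> hasType G a (subst s A) ->
  hasType G (App t a) (subst (scons a s) B).
Proof. intros H Ha; rewrite <- subst1_up; exact (ty_App _ _ _ _ _ H Ha). Qed.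

Lemma inh_inst G s A B a :
  inh G (subst s (Pi A B)) -> hasType G a (subst s A) ->
  inh G (subst (scons a s) B).
Proof. intros [t H] Ha; exists (App t a); exact (hasType_inst _ _ _ _ _ _ H Ha). Qed.

Lemma hasType_cst G c i j :
  wfCtx G -> hasType G (Cst c) (subst Var (close (constType c i j))).
Proof. intros W; rewrite subst_Var; apply ty_Cst, W. Qed.

(** * A sound type checker *)

Definition const_eq_dec (c d : const) : {c = d} + {c <> d}.
Proof. decide equality; apply Nat.eq_dec. Defined.

Definition term_eq_dec (t u : term) : {t = u} + {t <> u}.
Proof. decide equality; first [apply Nat.eq_dec | apply const_eq_dec]. Defined.

Definition same (l l' : list term) : bool :=
  if list_eq_dec term_eq_dec l l' then true else false.

Lemma same_eq l l' : same l l' = true -> l = l'.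
Proof. unfold same; destruct (list_eq_dec _ _ _); congruence. Qed.

Fixpoint spine (t : term) (l : list term) : term * list term :=
  match t with App f a => spine f (a :: l) | _ => (t, l) end.

Lemma spine_apps t l h l' : spine t l = (h, l') -> apps t l = apps h l'.
Proof.
  revert l; induction t; intros l E; simpl in E;
    try (injection E as <- <-; reflexivity).
  apply (IHt1 _ E).
Qed.

(** [compRule] repeats the parameters in eliminator and constructor, so a reduct is offered only
    when they agree syntactically; [nf] normalises the arguments first, which helps them to
    agree. *)
Definition iota (c : const) (l : list term) : option term :=
  match c, l with
  | cIndUnit, [P; e; Cst cStar] => Some e
  | cIndSum, [A; B; P; f; g; x] =>
      match spine x [] with
      | (Cst cInl, [A'; B'; a]) =>
          if same [A; B] [A'; B'] then Some (App f a) else None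
      | (Cst cInr, [A'; B'; b]) =>
          if same [A; B] [A'; B'] then Some (App g b) else None
      | _ => None
      end
  | cIndSig, [A; B; P; e; x] =>
      match spine x [] with
      | (Cst cPair, [A'; B'; a; b]) =>
          if same [A; B] [A'; B'] then Some (apps e [a; b]) else None
      | _ => None
      end
  | cIndNat, [P; z; s; Cst cZero] => Some z
  | cIndNat, [P; z; s; App (Cst cSucc) n] =>
      Some (apps s [n; apps (Cst cIndNat) [P; z; s; n]])
  | cIndId, [A; P; e; x; y; p] =>
      match spine p [] with
      | (Cst cRefl, [A'; z]) =>
          if same [A; x; y] [A'; z; z] then Some (App e z) else None
      | _ => None
      end
  | cIndTrunc, [A; P; h; e; x] =>
      match spine x [] with
      | (Cst cTruncIn, [A'; a]) => if same [A] [A'] then Some (App e a) else None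
      | _ => None
      end
  | cIndPushout, [A; B; C; f; g; P; l; r; h; x] =>
      match spine x [] with
      | (Cst cPushoutL, [A'; B'; C'; f'; g'; a]) =>
          if same [A; B; C; f; g] [A'; B'; C'; f'; g'] then Some (App l a) else None
      | (Cst cPushoutR, [A'; B'; C'; f'; g'; b]) =>
          if same [A; B; C; f; g] [A'; B'; C'; f'; g'] then Some (App r b) else None
      | _ => None
      end
  | _, _ => None
  end.

Lemma iota_conv c l u : iota c l = Some u -> conv (apps (Cst c) l) u.
Proof.
  unfold iota; intros E; apply conv_comp.
  repeat match type of E with
  | context [match spine ?x [] with _ => _ end] =>
      destruct (spine x []) eqn:?
  | (if ?b then _ else _) = _ => destruct b eqn:?
  | context [match ?x with _ => _ end] => is_var x; destruct x
  end; try discriminate; injection E as <-;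
  repeat match goal with
  | H : spine _ [] = _ |- _ => apply spine_apps in H; simpl in H; subst
  | H : same _ _ = true |- _ => apply same_eq in H; injection H as; subst
  end; constructor.
Qed.

Definition contract (t : term) : option term :=
  match t with
  | App (Lam t) a => Some (subst1 a t)
  | _ => match spine t [] with (Cst c, l) => iota c l | _ => None end
  end.

Lemma contract_conv t u : contract t = Some u -> conv t u.
Proof.
  assert (Hs : match spine t [] with (Cst c, l) => iota c l | _ => None end = Some u
               -> conv t u).
  { destruct (spine t []) as [h l] eqn:E; apply spine_apps in E; simpl in E.
    destruct h; try discriminate; rewrite E; apply iota_conv. }
  unfold contract; destruct t as [| | | |[]|]; intros E; try (apply Hs, E).
  injection E as <-; apply conv_comp, comp_beta.
Qed.

(** Raw terms may fail to normalise, hence the fuel. Whatever the fuel, the result is convertible to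
    the input, and soundness rests on this alone. *)
Fixpoint nf (n : nat) (t : term) : term :=
  match n with
  | 0 => t
  | S n =>
      match t with
      | Pi A B => Pi (nf n A) (nf n B)
      | Lam t => Lam (nf n t)
      | App f a =>
          let t := App (nf n f) (nf n a) in
          match contract t with Some u => nf n u | None => t end
      | _ => t
      end
  end.

Lemma nf_conv n t : conv t (nf n t).
Proof.
  revert t; induction n as [|n IH]; intros t; [apply conv_refl|].
  destruct t; cbn [nf]; try apply conv_refl.
  - apply conv_Pi; apply IH.
  - apply conv_Lam, IH.
  - eapply conv_trans; [apply conv_App; apply IH|].
    destruct (contract _) eqn:E; [|apply conv_refl].
    eapply conv_trans; [apply contract_conv, E | apply IH].
Qed.

Fixpoint eta (t : term) : term :=
  match t with
  | Pi A B => Pi (eta A) (eta B)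
  | Lam t =>
      match eta t with
      | App f (Var 0) as u =>
          (* [ren pred f] is a guess at undoing [lift]; the test confirms that variable 0 does not
             occur in [f]. *)
          if term_eq_dec (lift (ren pred f)) f then ren pred f else Lam u
      | u => Lam u
      end
  | App f a => App (eta f) (eta a)
  | _ => t
  end.

Lemma eta_conv t : conv t (eta t).
Proof.
  induction t; simpl; auto using conv_refl, conv_Pi, conv_App.
  eapply conv_trans; [apply conv_Lam, IHt|].
  destruct (eta t) as [| | | |f []|]; try apply conv_refl.
  destruct n; [|apply conv_refl].
  destruct (term_eq_dec _ _) as [E|]; [|apply conv_refl].
  rewrite <- E at 1; apply conv_comp, comp_eta.
Qed.

(* [constType c i j] is used at [i = 0] only.  The motive level [1] allows large
   elimination, and by cumulativity accepts a motive valued in [U 0] once it is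
   written as an abstraction; it would ill-type the identity types occurring in
   the premises of the eliminators of higher inductive types. *)
Definition motiveLevel (c : const) : nat :=
  match c with cIndTrunc | cIndSetQuot | cIndPushout | cIndPushoutGlue => 0 | _ => 1 end.

(* The reduct of a type is typed anew, so that no subject reduction is needed. *)
Fixpoint infer (n : nat) (G : ctx) (t : term) : option term :=
  match n with
  | 0 => None
  | S n =>
      match t with
      | Var k => option_map (ren (Nat.add (S k))) (nth_error G k)
      | U i => Some (U (S i))
      | Cst c => Some (close (constType c 0 (motiveLevel c)))
      | Lam _ => None
      | Pi A B =>
          match option_map (nf n) (infer n G A),
                option_map (nf n) (infer n (A :: G) B) with
          | Some (U i), Some (U j) => Some (U (max i j))
          | _, _ => None
          end
      | App f a =>
          match option_map (nf n) (infer n G f) with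
          | Some (Pi A B) =>
              match infer n G (Pi A B) with
              | Some (U _) => if check n G a A then Some (subst1 a B) else None
              | _ => None
              end
          | _ => None
          end
      end
  end
with check (n : nat) (G : ctx) (t T : term) : bool :=
  match n with
  | 0 => false
  | S n =>
      match t with
      | Lam t =>
          match nf n T with
          | Pi A B =>
              match infer n G (Pi A B) with
              | Some (U _) => check n (A :: G) t B
              | _ => false
              end
          | _ => false
          end
      | _ =>
          match option_map (nf n) (infer n G t), nf n T with
          | Some (U i), U j => i <=? j
          | Some V, W => same [eta V] [eta W]
          | None, _ => false
          end
      end
  end.

Lemma hasType_cumul G A i j : i <= j -> hasType G A (U i) -> hasType G A (U j).
Proof. induction 1; auto using ty_cumul. Qed.

(** Conversion and cumulativity change only the type, so every derivation for a product goes back to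
    the formation rule. *)
Lemma hasType_Pi_inv G A B X :
  hasType G (Pi A B) X ->
  exists i, hasType G A (U i) /\ hasType (A :: G) B (U i).
Proof.
  intros H; remember (Pi A B) as t eqn:E; induction H; try discriminate; eauto.
  injection E as <- <-; eauto.
Qed.

Lemma hasType_U_conv G A T i :
  wfCtx G -> hasType G A T -> conv T (U i) -> hasType G A (U i).
Proof. intros; eapply ty_conv; eauto using ty_U. Qed.

(** Both halves are proved together by induction on the fuel. [check] presupposes that its target is
    a type, as the conversion rule demands. *)
Lemma checker_sound n :
  (forall G t T, wfCtx G -> infer n G t = Some T -> hasType G t T) /\
  (forall G t T i, wfCtx G -> hasType G T (U i) -> check n G t T = true ->
     hasType G t T).
Proof.
  induction n as [|n [IHi IHc]]; [split; discriminate|].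
  (* A normal form is so far only convertible to an inferred type; it is not yet known to be a type
     itself. *)
  assert (Hnf : forall G t V, wfCtx G ->
            option_map (nf n) (infer n G t) = Some V ->
            exists T, hasType G t T /\ conv T V).
  { intros G t V W E; destruct (infer _ _ _) as [T|] eqn:ET; [|discriminate].
    injection E as <-; eauto using nf_conv. }
  split.
  - intros G t T W E; destruct t; simpl in E.
    + destruct (nth_error _ _) eqn:EA; [|discriminate]; injection E as <-.
      constructor; assumption.
    + injection E as <-; constructor; assumption.
    + destruct (option_map _ _) as [[]|] eqn:EA in E; try discriminate.
      destruct (option_map _ _) as [[]|] eqn:EB in E; try discriminate.
      injection E as <-.
      destruct (Hnf _ _ _ W EA) as (TA & HA & CA).
      apply hasType_U_conv with (i := i) in HA; auto.
      assert (W' : wfCtx (t1 :: G)) by (econstructor; eauto).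
      destruct (Hnf _ _ _ W' EB) as (TB & HB & CB).
      apply hasType_U_conv with (i := i0) in HB; auto.
      apply ty_Pi; (eapply hasType_cumul; [|eassumption]);
        [apply Nat.le_max_l | apply Nat.le_max_r].
    + discriminate.
    + destruct (option_map _ _) as [[]|] eqn:Ef; try discriminate.
      destruct (infer n G (Pi A B)) as [[]|] eqn:EP; try discriminate.
      destruct (check _ _ _ _) eqn:Ea; [|discriminate]; injection E as <-.
      destruct (Hnf _ _ _ W Ef) as (TF & HF & CF).
      apply IHi in EP; auto.
      destruct (hasType_Pi_inv _ _ _ _ EP) as (k & HA & HB).
      eapply ty_App; [eapply ty_conv; eauto | eauto].
    + injection E as <-; constructor; assumption.
  - intros G t T i W HT E.
    assert (Hn : match option_map (nf n) (infer n G t), nf n T with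
                 | Some (U i), U j => i <=? j
                 | Some V, W => same [eta V] [eta W]
                 | None, _ => false
                 end = true -> hasType G t T).
    { intros E'; destruct (option_map _ _) as [V|] eqn:EV; [|discriminate].
      destruct (Hnf _ _ _ W EV) as (T' & HT' & CT').
      assert (Hs : same [eta V] [eta (nf n T)] = true -> hasType G t T).
      { intros Es; apply same_eq in Es; injection Es as Es.
        eapply ty_conv; [exact HT' | exact HT |].
        eapply conv_trans; [exact CT'|].
        eapply conv_trans; [apply eta_conv|]; rewrite Es.
        eapply conv_trans; [apply conv_sym, eta_conv | apply conv_sym, nf_conv]. }
      (* Two universes are compared by level, using cumulativity; all other types by equality of
         eta-reduced normal forms. *)
      destruct V; try (apply Hs, E').
      destruct (nf n T) eqn:EN; try (apply Hs, E').
      apply Nat.leb_le in E'.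
      eapply ty_conv; [|exact HT|].
      - eapply hasType_cumul; [exact E'|]; eapply hasType_U_conv; eauto.
      - rewrite <- EN; apply conv_sym, nf_conv. }
    destruct t; try (apply Hn, E); simpl in E.
    destruct (nf n T) eqn:EN; try discriminate.
    destruct (infer _ _ _) as [[]|] eqn:EP; try discriminate.
    apply IHi in EP; auto.
    destruct (hasType_Pi_inv _ _ _ _ EP) as (k & HA & HB).
    apply ty_conv with (A := nf n T) (i := i); [rewrite EN | exact HT |].
    + eapply ty_Lam; [exact HA|].
      eapply IHc; eauto; econstructor; eauto.
    + apply conv_sym, nf_conv.
Qed.

(** The proposed type is itself checked first, as [check] presupposes. The fuel 200 is enough for
    the terms below. *)
Definition proves (t T : bterm) : bool :=
  match infer 200 [] (close T) with
  | Some (U _) => check 200 [] (close t) (close T)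
  | _ => false
  end.

Lemma proves_inh t T : proves t T = true -> inh [] (close T).
Proof.
  unfold proves; destruct (infer _ _ _) as [[]|] eqn:E; try discriminate; intros Ht.
  exists (close t).
  eapply checker_sound; eauto using wf_nil.
  eapply (proj1 (checker_sound _)); eauto using wf_nil.
Qed.
(** * Closed derivations *)

Ltac check_proof t := apply (proves_inh t); vm_compute; reflexivity.

Section ClosedDerivations.
Local Open Scope bterm_scope.

(** * The interval, a pushout of identity maps on the unit type, and function extensionality *)

Definition bInterval : bterm :=
  cPushout · cUnit · cUnit · cUnit · (λ x, x) · (λ x, x).
Definition bLeft (c : bterm) : bterm :=
  cPushoutL · cUnit · cUnit · cUnit · (λ x, x) · (λ x, x) · c.
Definition bRight (c : bterm) : bterm :=
  cPushoutR · cUnit · cUnit · cUnit · (λ x, x) · (λ x, x) · c.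
Definition bSegment (c : bterm) : bterm :=
  cGlue · cUnit · cUnit · cUnit · (λ x, x) · (λ x, x) · c.

(* The unfolding of [btransport bInterval (λ _i, A) a b q u]: the checker does
   not infer a type for a beta redex. *)
Definition bTransportConst (A a b q u : bterm) : bterm :=
  cIndId · bInterval · (λ _a, λ _b, λ _q, A ⇒ A) · (λ _a, λ v, v) · a · b · q · u.

(* A path from [u] to [v] is a function on the interval. *)
Definition bPathFun (A u v p i : bterm) : bterm :=
  cIndPushout · cUnit · cUnit · cUnit · (λ x, x) · (λ x, x)
    · (λ _i, A) · (λ _x, u) · (λ _x, v)
    · (λ c, cIndId · bInterval
         · (λ a, λ b, λ q, Π u' : A, Π v' : A, cId · A · u' · v' ⇒
              cId · A · bTransportConst A a b q u' · v')
         · (λ _a, λ _u, λ _v, λ r, r)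
         · bLeft c · bRight c · bSegment c · u · v · p)
    · i.

(** The action of [k] on the segment: a path from [k] at the left endpoint to [k] at the right
    one. *)
Definition bApSegment (A : bterm) (k : bterm -> bterm) : bterm :=
  cIndId · bInterval · (λ a, λ b, λ _q, cId · A · (k a) · (k b))
    · (λ a, cRefl · A · (k a)) · bLeft cStar · bRight cStar · bSegment cStar.

Definition isProp_piT : bterm :=
  Π A : bU 0, Π B : A ⇒ bU 0,
    (Π x : A, bisProp (B · x)) ⇒ bisProp (Π x : A, B · x).

(* Function extensionality is read off the interval. *)
Lemma isProp_pi : inh [] (close isProp_piT).
Proof.
  check_proof (λ A, λ B, λ h, λ f, λ g,
    (* At each point [i] of the interval stands the function sending [x] to the point [i] of the
       path from [f x] to [g x]; up to eta its endpoints are [f] and [g]. *)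
    bApSegment (Π x : A, B · x)
      (fun i => λ x, bPathFun (B · x) (f · x) (g · x) (h · x · (f · x) · (g · x)) i)).
Qed.


(** Families are Rocq functions here, so that their instances contain no beta redex for which the
    checker would have to infer a type. *)
Definition bTransport (A : bterm) (P : bterm -> bterm) (x y p u : bterm) : bterm :=
  cIndId · A · (λ a, λ b, λ _p, P a ⇒ P b) · (λ _a, λ v, v) · x · y · p · u.

Definition bAp (A B : bterm) (f : bterm -> bterm) (x y p : bterm) : bterm :=
  cIndId · A · (λ a, λ b, λ _p, cId · B · f a · f b)
    · (λ a, cRefl · B · f a) · x · y · p.

Definition bAbsurd (A x : bterm) : bterm := cIndEmpty · (λ _x, A) · x.

Definition bcase (A B C : bterm) (f g : bterm -> bterm) (x : bterm) : bterm :=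
  cIndSum · A · B · (λ _x, C) · (λ a, f a) · (λ b, g b) · x.

Definition bpair (A B a b : bterm) : bterm := cPair · A · (λ _a, B) · a · b.
Definition bfst (A B x : bterm) : bterm :=
  cIndSig · A · (λ _a, B) · (λ _x, A) · (λ a, λ _b, a) · x.
Definition bsnd (A B x : bterm) : bterm :=
  cIndSig · A · (λ _a, B) · (λ _x, B) · (λ _a, λ b, b) · x.

Lemma isProp_empty : inh [] (close (bisProp cEmpty)).
Proof. check_proof (λ x, λ y, bAbsurd (cId · cEmpty · x · y) x). Qed.

Lemma isProp_trunc : inh [] (close (Π A : bU 0, bisProp (cTrunc · A))).
Proof. check_proof (bcst cTruncPath). Qed.

(** Path induction on the path between first components leaves pairs with a common first component,
    to which the path between second components is applied. *)
Lemma isProp_prod :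
  inh [] (close (Π A : bU 0, Π B : bU 0, bisProp A ⇒ bisProp B ⇒ bisProp (bprod A B))).
Proof.
  check_proof (λ A, λ B, λ hA, λ hB, λ x, λ y,
    cIndSig · A · (λ _a, B) · (λ x, cId · bprod A B · x · y)
      · (λ a, λ b,
           cIndSig · A · (λ _a, B) · (λ y, cId · bprod A B · bpair A B a b · y)
             · (λ a', λ b',
                  cIndId · A
                    · (λ a, λ a', λ _p, cId · bprod A B · bpair A B a b · bpair A B a' b')
                    · (λ a, bAp B (bprod A B) (fun b => bpair A B a b) b b' (hB · b · b'))
                    · a · a' · (hA · a · a'))
             · y)
      · x).
Qed.

(** * Peano axioms and uniqueness of equality proofs on the natural numbers *)

Definition bRec (A z : bterm) (s : bterm -> bterm -> bterm) (n : bterm) : bterm :=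
  cIndNat · (λ _n, A) · z · (λ m, λ r, s m r) · n.

(** Large elimination: empty at zero and inhabited at successors, hence a discriminator for the
    two. *)
Definition bIsSucc (n : bterm) : bterm :=
  bRec (bU 0) cEmpty (fun _ _ => bcst cUnit) n.

Lemma succ_nonzero :
  inh [] (close (Π n : cNat, cId · cNat · (cSucc · n) · cZero ⇒ cEmpty)).
Proof.
  check_proof (λ n, λ p, bTransport cNat bIsSucc (cSucc · n) cZero p cStar).
Qed.

Lemma succ_inj :
  inh [] (close (Π m : cNat, Π n : cNat,
    cId · cNat · (cSucc · m) · (cSucc · n) ⇒ cId · cNat · m · n)).
Proof.
  check_proof (λ m, λ n, λ p,
    bAp cNat cNat (bRec cNat cZero (fun m _ => m)) (cSucc · m) (cSucc · n) p).
Qed.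

(** Observational equality of numbers. The outer recursion has a function type as its motive, so
    that the second number stays free. *)
Definition bCode (m n : bterm) : bterm :=
  cIndNat · (λ _m, cNat ⇒ bU 0)
    · (λ n, bRec (bU 0) cUnit (fun _ _ => bcst cEmpty) n)
    · (λ _m, λ c, λ n, bRec (bU 0) cEmpty (fun n _ => c · n) n)
    · m · n.

Definition bCodeRefl (m : bterm) : bterm :=
  cIndNat · (λ m, bCode m m) · cStar · (λ _m, λ r, r) · m.

Definition bDecode (m n : bterm) : bterm :=
  cIndNat · (λ m, Π n : cNat, bCode m n ⇒ cId · cNat · m · n)
    · (λ n, cIndNat · (λ n, bCode cZero n ⇒ cId · cNat · cZero · n)
         · (λ _c, cRefl · cNat · cZero)
         · (λ n, λ _r, λ c, bAbsurd (cId · cNat · cZero · (cSucc · n)) c) · n)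
    · (λ m, λ d, λ n,
         cIndNat · (λ n, bCode (cSucc · m) n ⇒ cId · cNat · (cSucc · m) · n)
         · (λ c, bAbsurd (cId · cNat · (cSucc · m) · cZero) c)
         · (λ n, λ _r, λ c, bAp cNat cNat (bapp cSucc) m n (d · n · c)) · n)
    · m · n.

(** In the successor case decoding computes to the action of [cSucc] on the decoded path, and this
    action computes to [cRefl] on [cRefl]. *)
Definition bDecodeRefl (m : bterm) : bterm :=
  cIndNat
    · (λ m, cId · (cId · cNat · m · m) · (bDecode m m · bCodeRefl m) · (cRefl · cNat · m))
    · (cRefl · (cId · cNat · cZero · cZero) · (cRefl · cNat · cZero))
    · (λ m, λ r,
         bAp (cId · cNat · m · m) (cId · cNat · (cSucc · m) · (cSucc · m))
           (bAp cNat cNat (bapp cSucc) m m)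
           (bDecode m m · bCodeRefl m) (cRefl · cNat · m) r)
    · m.

Definition bEncode (m n p : bterm) : bterm :=
  cIndId · cNat · (λ m, λ n, λ _p, bCode m n) · (λ m, bCodeRefl m) · m · n · p.

Definition bDecodeEncode (m n p : bterm) : bterm :=
  cIndId · cNat
    · (λ m, λ n, λ p, cId · (cId · cNat · m · n) · (bDecode m n · bEncode m n p) · p)
    · (λ m, bDecodeRefl m) · m · n · p.

Definition bCodeProp (m n : bterm) : bterm :=
  cIndNat · (λ m, Π n : cNat, bisProp (bCode m n))
    · (λ n, cIndNat · (λ n, bisProp (bCode cZero n))
         · (λ x, λ y, cIndUnit · (λ x, cId · cUnit · x · y)
              · (cIndUnit · (λ y, cId · cUnit · cStar · y) · (cRefl · cUnit · cStar) · y)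
              · x)
         · (λ n, λ _r, λ x, λ y, bAbsurd (cId · cEmpty · x · y) x) · n)
    · (λ m, λ h, λ n, cIndNat · (λ n, bisProp (bCode (cSucc · m) n))
         · (λ x, λ y, bAbsurd (cId · cEmpty · x · y) x)
         · (λ n, λ _r, h · n) · n)
    · m · n.

(** Euclid's first common notion: symmetry and transitivity in a single path induction. *)
Definition bEuclid (A z x y p q : bterm) : bterm :=
  cIndId · A · (λ z, λ x, λ _p, cId · A · z · y ⇒ cId · A · x · y)
    · (λ _z, λ q, q) · z · x · p · q.

(* Encode-decode: a path is recovered from its code, and codes are unique. *)
Lemma isSet_nat :
  inh [] (close (Π m : cNat, Π n : cNat, bisProp (cId · cNat · m · n))).
Proof.
  check_proof (λ m, λ n, λ p, λ q,
    (* The codes of [p] and [q] are equal. Path induction on that equality leaves a single code, of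
       which both [p] and [q] are the decoding. *)
    cIndId · bCode m n
      · (λ x, λ y, λ _r, Π p : cId · cNat · m · n, Π q : cId · cNat · m · n,
           cId · (cId · cNat · m · n) · (bDecode m n · x) · p ⇒
           cId · (cId · cNat · m · n) · (bDecode m n · y) · q ⇒
           cId · (cId · cNat · m · n) · p · q)
      · (λ x, λ p, λ q, λ h, λ k,
           bEuclid (cId · cNat · m · n) (bDecode m n · x) p q h k)
      · bEncode m n p · bEncode m n q
      · (bCodeProp m n · bEncode m n p · bEncode m n q)
      · p · q · bDecodeEncode m n p · bDecodeEncode m n q).
Qed.

(** Excluded middle gives a truncated decision of [P], which may be eliminated because the goal [P]
    is itself a proposition. *)
Lemma reductio :
  inh [] (close (Π P : bU 0, bisProp P ⇒ ((P ⇒ cEmpty) ⇒ cEmpty) ⇒ P)).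
Proof.
  check_proof (λ P, λ h, λ k,
    cIndTrunc · (cSum · P · bnot P) · (λ _x, P) · (λ _x, h)
      · (λ x, bcase P (bnot P) P (fun p => p) (fun n => bAbsurd P (k · n)) x)
      · (cLEM · P · h)).
Qed.

(** * Introduction and elimination rules of the connectives and of equality *)

Lemma prod_intro :
  inh [] (close (Π A : bU 0, Π B : bU 0, A ⇒ B ⇒ bprod A B)).
Proof. check_proof (λ A, λ B, λ a, λ b, bpair A B a b). Qed.

Lemma prod_fst : inh [] (close (Π A : bU 0, Π B : bU 0, bprod A B ⇒ A)).
Proof. check_proof (λ A, λ B, λ x, bfst A B x). Qed.

Lemma prod_snd : inh [] (close (Π A : bU 0, Π B : bU 0, bprod A B ⇒ B)).
Proof. check_proof (λ A, λ B, λ x, bsnd A B x). Qed.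

Lemma or_introl :
  inh [] (close (Π A : bU 0, Π B : bU 0, A ⇒ cTrunc · (cSum · A · B))).
Proof. check_proof (λ A, λ B, λ a, cTruncIn · (cSum · A · B) · (cInl · A · B · a)). Qed.

Lemma or_intror :
  inh [] (close (Π A : bU 0, Π B : bU 0, B ⇒ cTrunc · (cSum · A · B))).
Proof. check_proof (λ A, λ B, λ b, cTruncIn · (cSum · A · B) · (cInr · A · B · b)). Qed.

Lemma or_elim :
  inh [] (close (Π A : bU 0, Π B : bU 0, Π C : bU 0, bisProp C ⇒
    cTrunc · (cSum · A · B) ⇒ (A ⇒ C) ⇒ (B ⇒ C) ⇒ C)).
Proof.
  check_proof (λ A, λ B, λ C, λ h, λ x, λ f, λ g,
    cIndTrunc · (cSum · A · B) · (λ _x, C) · (λ _x, h)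
      · (λ x, bcase A B C (bapp f) (bapp g) x) · x).
Qed.

Lemma exists_intro :
  inh [] (close (Π A : bU 0, Π B : A ⇒ bU 0, Π a : A, B · a ⇒ cTrunc · (cSig · A · B))).
Proof.
  check_proof (λ A, λ B, λ a, λ b, cTruncIn · (cSig · A · B) · (cPair · A · B · a · b)).
Qed.

Lemma exists_elim :
  inh [] (close (Π A : bU 0, Π B : A ⇒ bU 0, Π C : bU 0, bisProp C ⇒
    cTrunc · (cSig · A · B) ⇒ (Π a : A, B · a ⇒ C) ⇒ C)).
Proof.
  check_proof (λ A, λ B, λ C, λ h, λ x, λ f,
    cIndTrunc · (cSig · A · B) · (λ _x, C) · (λ _x, h)
      · (λ x, cIndSig · A · B · (λ _x, C) · f · x) · x).
Qed.

Lemma eq_refl_nat : inh [] (close (Π n : cNat, cId · cNat · n · n)).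
Proof. check_proof (λ n, cRefl · cNat · n). Qed.

Lemma transport_nat :
  inh [] (close (Π P : cNat ⇒ bU 0, Π m : cNat, Π n : cNat,
    cId · cNat · m · n ⇒ P · m ⇒ P · n)).
Proof. check_proof (λ P, λ m, λ n, λ p, λ u, bTransport cNat (bapp P) m n p u). Qed.

(** * Decisions of propositions and comprehension *)

Definition bOne : bterm := cSucc · cZero.

(** [inh] hides the proof term of [isProp_pi], so its type enters as a premise, which is discharged
    in [comprehension]. *)
Definition isProp_decT : bterm :=
  isProp_piT ⇒ Π P : bU 0, bisProp P ⇒ bisProp (cSum · P · bnot P).

Definition comprehensionT : bterm :=
  Π P : cNat ⇒ bU 0, (Π n : cNat, bisProp (P · n)) ⇒
    cTrunc · (cSig · (cNat ⇒ cNat) · (λ f, Π n : cNat,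
      bprod (cId · cNat · (f · n) · bOne ⇒ P · n)
            (P · n ⇒ cId · cNat · (f · n) · bOne))).

(** Decisions on opposite sides contradict each other; on the same side they agree because [P] and
    its negation are propositions. *)
Lemma isProp_dec_of_pi : inh [] (close isProp_decT).
Proof.
  check_proof (λ pi, λ P, λ h, λ x, λ y,
    let D := cSum · P · bnot P in
    cIndSum · P · bnot P · (λ x, cId · D · x · y)
      · (λ p, cIndSum · P · bnot P · (λ y, cId · D · (cInl · P · bnot P · p) · y)
           · (λ q, bAp P D (bapp (cInl · P · bnot P)) p q (h · p · q))
           · (λ n, bAbsurd (cId · D · (cInl · P · bnot P · p) · (cInr · P · bnot P · n))
                     (n · p))
           · y)
      · (λ n, cIndSum · P · bnot P · (λ y, cId · D · (cInr · P · bnot P · n) · y)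
           · (λ p, bAbsurd (cId · D · (cInr · P · bnot P · n) · (cInl · P · bnot P · p))
                     (n · p))
           (* A negation is a product of empty types, so [pi] makes it a proposition. *)
           · (λ m, bAp (bnot P) D (bapp (cInr · P · bnot P)) n m
                (pi · P · (λ _p, cEmpty) · (λ _p, λ x, λ y, bAbsurd (cId · cEmpty · x · y) x)
                   · n · m))
           · y)
      · x).
Qed.

Lemma comprehension_of_dec :
  inh [] (close ((Π P : bU 0, bisProp P ⇒ bisProp (cSum · P · bnot P)) ⇒ comprehensionT)).
Proof.
  check_proof (λ hd, λ P, λ h,
    (* By [hd] decisions form a proposition, so a decision leaves its truncation by induction with
       the identity. *)
    let dec n :=
      cIndTrunc · (cSum · (P · n) · bnot (P · n)) · (λ _x, cSum · (P · n) · bnot (P · n))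
        · (λ _x, hd · (P · n) · (h · n)) · (λ x, x) · (cLEM · (P · n) · (h · n)) in
    let chi n x := bcase (P · n) (bnot (P · n)) cNat (fun _ => bOne) (fun _ => bcst cZero) x in
    let holds n x := cId · cNat · chi n x · bOne in
    let T := λ f, Π n : cNat,
      bprod (cId · cNat · (f · n) · bOne ⇒ P · n)
            (P · n ⇒ cId · cNat · (f · n) · bOne) in
    cTruncIn · (cSig · (cNat ⇒ cNat) · T)
      · (cPair · (cNat ⇒ cNat) · T · (λ n, chi n (dec n))
           (* The decision [dec n] is generalised to an arbitrary [x], since [chi] computes only on
              the two injections. *)
           · (λ n, cIndSum · (P · n) · bnot (P · n)
                · (λ x, bprod (holds n x ⇒ P · n) (P · n ⇒ holds n x))
                · (λ p, bpair (cId · cNat · bOne · bOne ⇒ P · n)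
                              (P · n ⇒ cId · cNat · bOne · bOne)
                          (λ _e, p) (λ _p, cRefl · cNat · bOne))
                · (λ m, bpair (cId · cNat · cZero · bOne ⇒ P · n)
                              (P · n ⇒ cId · cNat · cZero · bOne)
                          (* An equality of zero and one is refuted by a family inhabited at zero
                             and empty at successors. *)
                          (λ e, bAbsurd (P · n)
                             (bTransport cNat
                                (fun k => bRec (bU 0) cUnit (fun _ _ => bcst cEmpty) k)
                                cZero bOne e cStar))
                          (λ p, bAbsurd (cId · cNat · cZero · bOne) (m · p)))
                · dec n))).
Qed.

End ClosedDerivations.

Lemma comprehension : inh [] (close comprehensionT).
Proof.
  destruct isProp_pi as [pi Hpi], isProp_dec_of_pi as [d Hd],
    comprehension_of_dec as [c Hc].
  exists (App c (App d pi)).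
  exact (ty_App _ _ _ _ _ Hc (ty_App _ _ _ _ _ Hd Hpi)).
Qed.

(** * The interpretation in de Bruijn form *)

Definition tZero : term := Cst cZero.
Definition tNat : term := Cst cNat.
Definition tFun : term := Pi tNat tNat.
Definition tOne : term := App (Cst cSucc) tZero.
Definition tSig (A B : term) : term := apps (Cst cSig) [A; B].
Definition tProd (A B : term) : term := tSig A (Lam (lift B)).
Definition tOr (A B : term) : term := App (Cst cTrunc) (apps (Cst cSum) [A; B]).
Definition tEx (A B : term) : term := App (Cst cTrunc) (tSig A (Lam B)).
Definition tImp (A B : term) : term := Pi A (lift B).
Definition tEq (A a b : term) : term := apps (Cst cId) [A; a; b].
Definition tIsProp (A : term) : term :=
  Pi A (Pi (lift A) (tEq (lift (lift A)) (Var 1) (Var 0))).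

Definition tAdd (m n : term) : term :=
  apps (Cst cIndNat) [Lam tNat; m; Lam (Lam (App (Cst cSucc) (Var 0))); n].
Definition tMul (m n : term) : term :=
  apps (Cst cIndNat)
    [Lam tNat; tZero; Lam (Lam (tAdd (Var 0) (lift (lift m)))); n].

Fixpoint itm (e : nat -> term) (t : tm) : term :=
  match t with
  | TVar n => e n
  | TZero => tZero
  | TSucc t => App (Cst cSucc) (itm e t)
  | TAdd t u => tAdd (itm e t) (itm e u)
  | TMul t u => tMul (itm e t) (itm e u)
  end.

Definition liftEnv (e : nat -> term) (n : nat) : term := lift (e n).

(** Environments hold terms of the current context, lifted under each binder, so that substitution
    and renaming act on the interpretation through the environments alone. *)
Fixpoint ifm (e s : nat -> term) (p : form) : term :=
  match p with
  | FEq t u => tEq tNat (itm e t) (itm e u)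
  | FMem t X => tEq tNat (App (s X) (itm e t)) tOne
  | FBot => Cst cEmpty
  | FAnd p q => tProd (ifm e s p) (ifm e s q)
  | FOr p q => tOr (ifm e s p) (ifm e s q)
  | FImp p q => tImp (ifm e s p) (ifm e s q)
  | FAll1 p => Pi tNat (ifm (up e) (liftEnv s) p)
  | FEx1 p => tEx tNat (ifm (up e) (liftEnv s) p)
  | FAll2 p => Pi tFun (ifm (liftEnv e) (up s) p)
  | FEx2 p => tEx tFun (ifm (liftEnv e) (up s) p)
  end.

Lemma itm_ext e e' t : (forall n, e n = e' n) -> itm e t = itm e' t.
Proof. intros E; induction t; simpl; congruence. Qed.

Lemma up_ext s s' : (forall n, s n = s' n) -> forall n, up s n = up s' n.
Proof. intros E [|n]; unfold up; simpl; congruence. Qed.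

Lemma liftEnv_ext s s' :
  (forall n, s n = s' n) -> forall n, liftEnv s n = liftEnv s' n.
Proof. intros E n; unfold liftEnv; congruence. Qed.

Lemma ifm_ext p e e' s s' :
  (forall n, e n = e' n) -> (forall n, s n = s' n) -> ifm e s p = ifm e' s' p.
Proof.
  revert e e' s s'; induction p; intros e e' s s' E F; simpl;
    rewrite ?(itm_ext e e'), ?F by assumption;
    f_equal; auto using up_ext, liftEnv_ext.
Qed.

Lemma subst_itm r e t : subst r (itm e t) = itm (fun n => subst r (e n)) t.
Proof.
  induction t; cbn [itm]; unfold tMul, tAdd; simpl;
    rewrite ?subst_lift, ?IHt, ?IHt1, ?IHt2; reflexivity.
Qed.

Lemma subst_ifm p r e s :
  subst r (ifm e s p) = ifm (fun n => subst r (e n)) (fun n => subst r (s n)) p.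
Proof.
  assert (Hup : forall r e n, subst (up r) (up e n) = up (fun n => subst r (e n)) n).
  { intros r' e' [|n]; [reflexivity | apply subst_lift]. }
  assert (Hlift : forall r e n,
            subst (up r) (liftEnv e n) = liftEnv (fun n => subst r (e n)) n).
  { intros; apply subst_lift. }
  revert r e s; induction p; intros r e s; simpl;
    unfold tProd, tImp; rewrite ?subst_itm, ?subst_lift;
    try (rewrite IHp1, IHp2; reflexivity); try reflexivity;
    rewrite IHp;
    first [ rewrite (ifm_ext p _ _ _ _ (Hup _ _) (Hlift _ _))
          | rewrite (ifm_ext p _ _ _ _ (Hlift _ _) (Hup _ _)) ]; reflexivity.
Qed.

Lemma ren_ifm p r e s :
  ren r (ifm e s p) = ifm (fun n => ren r (e n)) (fun n => ren r (s n)) p.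
Proof.
  rewrite ren_as_subst, subst_ifm; apply ifm_ext; intros n;
    symmetry; apply ren_as_subst.
Qed.

Lemma lift_itm e t : itm (liftEnv e) t = lift (itm e t).
Proof.
  unfold lift; rewrite ren_as_subst, subst_itm.
  apply itm_ext; intros n; apply ren_as_subst.
Qed.

Lemma itm_tsub e f t : itm e (tsub f t) = itm (fun n => itm e (f n)) t.
Proof. induction t; simpl; congruence. Qed.

(** With [subst_ifm] this turns instantiation of a formula into substitution of a term, as the
    quantifier rules need. *)
Lemma ifm_fsub p e s f r :
  ifm e s (fsub f r p) = ifm (fun n => itm e (f n)) (fun n => s (r n)) p.
Proof.
  assert (Hup : forall e f n, itm (up e) (tup f n) = up (fun n => itm e (f n)) n).
  { intros e' f' [|n]; [reflexivity|]; unfold up, tup; simpl.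
    rewrite itm_tsub; apply lift_itm. }
  assert (Hsup : forall s r n,
            up s (scons 0 (fun n => S (r n)) n) = up (fun n => s (r n)) n).
  { intros s' r' [|n]; reflexivity. }
  revert e s f r; induction p; intros e s f r; simpl; rewrite ?itm_tsub;
    try (rewrite IHp1, IHp2; reflexivity); try reflexivity;
    rewrite IHp.
  - rewrite (ifm_ext p _ _ _ _ (Hup _ _) (fun _ => eq_refl)); reflexivity.
  - rewrite (ifm_ext p _ _ _ _ (Hup _ _) (fun _ => eq_refl)); reflexivity.
  - rewrite (ifm_ext p _ _ _ _ (fun n => lift_itm e (f n)) (Hsup _ _)); reflexivity.
  - rewrite (ifm_ext p _ _ _ _ (fun n => lift_itm e (f n)) (Hsup _ _)); reflexivity.
Qed.

Lemma lift_ifm e s p : ifm (liftEnv e) (liftEnv s) p = lift (ifm e s p).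
Proof. symmetry; apply ren_ifm. Qed.

(** A scheme is read at the depth of its use, which may exceed [d] by any number [k] of binders
    entered since; its value there is the weakened term. *)
Definition envAt (d : nat) (b : nat -> bterm) (e : nat -> term) : Prop :=
  forall n k, b n (k + d) = ren (Nat.add k) (e n).

Lemma envAt_lift d b e : envAt d b e -> envAt (S d) b (liftEnv e).
Proof.
  intros H n k; unfold liftEnv, lift; rewrite <- Nat.add_succ_comm, H, ren_ren.
  apply ren_ext; intros m; apply Nat.add_succ_comm.
Qed.

Lemma envAt_up d b e :
  envAt d b e -> envAt (S d) (scons (fun d' => Var (d' - S d)) b) (up e).
Proof.
  intros H [|n] k; simpl; [f_equal; lia | apply (envAt_lift _ _ _ H n k)].
Qed.

Lemma interpTm_itm t d b e : envAt d b e -> interpTm b t d = itm e t.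
Proof.
  revert d e; induction t; intros d e H; simpl;
    unfold bmul, badd, bapp, blam, bcst; rewrite ?Nat.sub_diag.
  - rewrite (H n 0 : b n d = _), ren_as_subst; apply subst_Var.
  - reflexivity.
  - rewrite (IHt d e H); reflexivity.
  - rewrite (IHt1 d e H), (IHt2 d e H); reflexivity.
  - rewrite (IHt2 d e H), (IHt1 _ _ (envAt_lift _ _ _ (envAt_lift _ _ _ H))).
    rewrite !lift_itm; reflexivity.
Qed.

Lemma interpForm_ifm p d b c e s :
  envAt d b e -> envAt d c s -> interpForm b c p d = ifm e s p.
Proof.
  revert d b c e s; induction p; intros d b c e s H K; simpl;
    unfold bprod, bpi, bapp, blam, bcst; simpl.
  - rewrite !(interpTm_itm _ d b e H); reflexivity.
  - rewrite !(interpTm_itm _ d b e H), (K X 0 : c X d = _), ren_as_subst.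
    change (fun n => Var (0 + n)) with Var; rewrite subst_Var; reflexivity.
  - reflexivity.
  (* The second conjunct stands under the binder of the constant family in [bprod], hence at depth
     [S d]. *)
  - rewrite (IHp1 d b c e s), (IHp2 (S d) b c (liftEnv e) (liftEnv s)), lift_ifm
      by auto using envAt_lift; reflexivity.
  - rewrite (IHp1 d b c e s), (IHp2 d b c e s) by auto; reflexivity.
  - rewrite (IHp1 d b c e s), (IHp2 (S d) b c (liftEnv e) (liftEnv s)), lift_ifm
      by auto using envAt_lift; reflexivity.
  - rewrite (IHp (S d) _ c (up e) (liftEnv s))
      by auto using envAt_lift, envAt_up; reflexivity.
  - rewrite (IHp (S d) _ c (up e) (liftEnv s))
      by auto using envAt_lift, envAt_up; reflexivity.
  - rewrite (IHp (S d) b _ (liftEnv e) (up s))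
      by auto using envAt_lift, envAt_up; reflexivity.
  - rewrite (IHp (S d) b _ (liftEnv e) (up s))
      by auto using envAt_lift, envAt_up; reflexivity.
Qed.

Lemma interp_ifm p : interp p = ifm (fun _ => tZero) (fun _ => Lam tZero) p.
Proof. apply interpForm_ifm; intros n k; reflexivity. Qed.

Lemma isProp_tIsProp A : isProp A = tIsProp A.
Proof.
  unfold tIsProp, lift; rewrite ren_ren.
  assert (E : ren (Nat.add 0) A = A) by (rewrite ren_as_subst; apply subst_Var).
  rewrite <- E at 2; reflexivity.
Qed.

(** * Formation rules *)

Lemma nat_type G : wfCtx G -> hasType G tNat (U 0).
Proof. exact (ty_Cst G cNat 0 0). Qed.

Lemma zero_type G : wfCtx G -> hasType G tZero tNat.
Proof. exact (ty_Cst G cZero 0 0). Qed.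

Lemma succ_type G t :
  wfCtx G -> hasType G t tNat -> hasType G (App (Cst cSucc) t) tNat.
Proof. intros W; exact (ty_App G tNat tNat (Cst cSucc) t (ty_Cst G cSucc 0 0 W)). Qed.

Lemma fun_type G : wfCtx G -> hasType G tFun (U 0).
Proof.
  intros W; apply ty_Pi; [|apply nat_type; econstructor]; eauto using nat_type.
Qed.

Lemma eq_type G A a b :
  wfCtx G -> hasType G A (U 0) -> hasType G a A -> hasType G b A ->
  hasType G (tEq A a b) (U 0).
Proof.
  intros W HA Ha Hb.
  exact (hasType_inst _ _ _ _ _ _ (hasType_inst _ _ _ _ _ _
           (hasType_inst _ _ _ _ _ _ (hasType_cst G cId 0 0 W) HA) Ha) Hb).
Qed.

Lemma sig_type G A B :
  wfCtx G -> hasType G A (U 0) -> hasType G B (Pi A (U 0)) ->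
  hasType G (tSig A B) (U 0).
Proof.
  intros W HA HB.
  exact (hasType_inst _ _ _ _ _ _
           (hasType_inst _ _ _ _ _ _ (hasType_cst G cSig 0 0 W) HA) HB).
Qed.

Lemma trunc_type G A : wfCtx G -> hasType G A (U 0) -> hasType G (App (Cst cTrunc) A) (U 0).
Proof. intros W HA; exact (hasType_inst _ _ _ _ _ _ (hasType_cst G cTrunc 0 0 W) HA). Qed.

Lemma imp_type G A B :
  wfCtx G -> hasType G A (U 0) -> hasType G B (U 0) -> hasType G (tImp A B) (U 0).
Proof.
  intros W HA HB; apply ty_Pi; [exact HA|].
  apply (hasType_lift _ _ _ _ (wf_cons _ _ _ W HA) HB).
Qed.

Lemma const_fam_type G A B :
  wfCtx G -> hasType G A (U 0) -> hasType G B (U 0) ->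
  hasType G (Lam (lift B)) (Pi A (U 0)).
Proof.
  intros W HA HB; eapply ty_Lam; [exact HA|].
  apply (hasType_lift _ _ _ _ (wf_cons _ _ _ W HA) HB).
Qed.

Lemma prod_type G A B :
  wfCtx G -> hasType G A (U 0) -> hasType G B (U 0) -> hasType G (tProd A B) (U 0).
Proof. intros; apply sig_type; auto using const_fam_type. Qed.

Lemma or_type G A B :
  wfCtx G -> hasType G A (U 0) -> hasType G B (U 0) -> hasType G (tOr A B) (U 0).
Proof.
  intros W HA HB; apply trunc_type; [exact W|].
  exact (hasType_inst _ _ _ _ _ _
           (hasType_inst _ _ _ _ _ _ (hasType_cst G cSum 0 0 W) HA) HB).
Qed.

Lemma ex_type G A B :
  wfCtx G -> hasType G A (U 0) -> hasType (A :: G) B (U 0) -> hasType G (tEx A B) (U 0).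
Proof.
  intros W HA HB; apply trunc_type, sig_type; auto; eapply ty_Lam; eauto.
Qed.

Lemma isProp_type G A :
  wfCtx G -> hasType G A (U 0) -> hasType G (tIsProp A) (U 0).
Proof.
  intros W HA.
  assert (W1 : wfCtx (A :: G)) by (econstructor; eauto).
  assert (HA1 : hasType (A :: G) (lift A) (U 0)) by apply (hasType_lift _ _ _ _ W1 HA).
  assert (W2 : wfCtx (lift A :: A :: G)) by (econstructor; eauto).
  apply ty_Pi; [exact HA|]; apply ty_Pi; [exact HA1|].
  apply eq_type; [exact W2 | apply (hasType_lift _ _ _ _ W2 HA1) | |].
  - change (lift (lift A)) with (ren S (ren S A)); rewrite ren_ren.
    exact (ty_Var _ 1 A W2 eq_refl).
  - exact (ty_Var _ 0 (lift A) W2 eq_refl).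
Qed.

Lemma beta_const A a : conv (App (Lam (lift A)) a) A.
Proof. rewrite <- (subst1_lift a A) at 2; apply conv_comp, comp_beta. Qed.

(** The dependent eliminator at a constant motive types its premises by redexes [App (Lam tNat) a];
    each is converted to [tNat]. *)
Lemma rec_type G z s n :
  wfCtx G -> hasType G z tNat -> hasType (tNat :: tNat :: G) s tNat ->
  hasType G n tNat ->
  hasType G (apps (Cst cIndNat) [Lam tNat; z; Lam (Lam s); n]) tNat.
Proof.
  intros W Hz Hs Hn.
  assert (HP : forall D, wfCtx D -> hasType D (Lam tNat) (Pi tNat (U 0))).
  { intros D WD; exact (const_fam_type _ _ _ WD (nat_type _ WD) (nat_type _ WD)). }
  assert (HPa : forall D a, wfCtx D -> hasType D a tNat ->
            hasType D (App (Lam tNat) a) (U 0)).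
  { intros D a WD; exact (ty_App _ _ _ _ _ (HP D WD)). }
  assert (C : forall a, conv (App (Lam tNat) a) tNat) by (exact (beta_const tNat)).
  assert (W1 : wfCtx (tNat :: G)) by (econstructor; eauto using nat_type).
  assert (W2 : wfCtx (tNat :: tNat :: G)) by (econstructor; eauto using nat_type).
  assert (W2' : wfCtx (App (Lam tNat) (Var 0) :: tNat :: G)).
  { econstructor; [exact W1|]; apply HPa; [exact W1 | exact (ty_Var _ 0 _ W1 eq_refl)]. }
  assert (Hf : hasType G (Lam (Lam s))
     (Pi tNat (Pi (App (Lam tNat) (Var 0)) (App (Lam tNat) (App (Cst cSucc) (Var 1)))))).
  { apply ty_conv with (A := Pi tNat (Pi tNat tNat)) (i := 0).
    - eapply ty_Lam; [apply nat_type, W|]; eapply ty_Lam; [apply nat_type, W1 | exact Hs].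
    - apply ty_Pi; [apply nat_type, W|].
      apply ty_Pi; apply HPa; auto; [exact (ty_Var _ 0 _ W1 eq_refl)|].
      apply succ_type; [exact W2' | exact (ty_Var _ 1 _ W2' eq_refl)].
    - auto using conv_Pi, conv_refl, conv_sym. }
  assert (Hz' : hasType G z (App (Lam tNat) tZero)).
  { eapply ty_conv; [exact Hz | apply HPa; auto using zero_type | apply conv_sym, C]. }
  eapply ty_conv; [|apply nat_type, W | apply (C n)].
  exact (hasType_inst _ _ _ _ _ _ (hasType_inst _ _ _ _ _ _
           (hasType_inst _ _ _ _ _ _ (hasType_inst _ _ _ _ _ _
             (hasType_cst G cIndNat 0 0 W) (HP G W)) Hz') Hf) Hn).
Qed.

Lemma add_type G m n :
  wfCtx G -> hasType G m tNat -> hasType G n tNat -> hasType G (tAdd m n) tNat.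
Proof.
  intros W Hm Hn; apply rec_type; auto.
  assert (W1 : wfCtx (tNat :: G)) by (econstructor; eauto using nat_type).
  assert (W2 : wfCtx (tNat :: tNat :: G)) by (econstructor; eauto using nat_type).
  apply succ_type; [exact W2 | exact (ty_Var _ 0 _ W2 eq_refl)].
Qed.

Lemma mul_type G m n :
  wfCtx G -> hasType G m tNat -> hasType G n tNat -> hasType G (tMul m n) tNat.
Proof.
  intros W Hm Hn; apply rec_type; auto using zero_type.
  assert (W1 : wfCtx (tNat :: G)) by (econstructor; eauto using nat_type).
  assert (W2 : wfCtx (tNat :: tNat :: G)) by (econstructor; eauto using nat_type).
  apply add_type; [exact W2 | exact (ty_Var _ 0 _ W2 eq_refl)|].
  exact (hasType_lift _ _ _ _ W2 (hasType_lift _ _ _ _ W1 Hm)).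
Qed.

(** Values are given at every index, so one notion serves open formulas and sentences alike. The
    types used for [T] are the closed [tNat] and [tFun], which [lift] fixes. *)
Definition envTyped (G : ctx) (e : nat -> term) (T : term) : Prop :=
  forall n, hasType G (e n) T.

Lemma envTyped_lift G A e T :
  wfCtx (A :: G) -> envTyped G e T -> envTyped (A :: G) (liftEnv e) (lift T).
Proof. intros W H n; apply hasType_lift; auto. Qed.

Lemma envTyped_up G e T :
  wfCtx (T :: G) -> envTyped G e T -> envTyped (T :: G) (up e) (lift T).
Proof.
  intros W H [|n]; [exact (ty_Var _ 0 _ W eq_refl) | apply hasType_lift; auto].
Qed.

Lemma itm_type G e t : wfCtx G -> envTyped G e tNat -> hasType G (itm e t) tNat.
Proof.
  intros W H; induction t; simpl;
    auto using zero_type, succ_type, add_type, mul_type.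
Qed.

Definition env (G : ctx) (e s : nat -> term) : Prop :=
  wfCtx G /\ envTyped G e tNat /\ envTyped G s tFun.

Lemma env_lift G A e s i :
  env G e s -> hasType G A (U i) -> env (A :: G) (liftEnv e) (liftEnv s).
Proof.
  intros (W & He & Hs) HA; assert (W' : wfCtx (A :: G)) by (econstructor; eauto).
  split; [exact W'|]; split; [exact (envTyped_lift _ _ _ _ W' He)
                             | exact (envTyped_lift _ _ _ _ W' Hs)].
Qed.

Lemma env_up1 G e s : env G e s -> env (tNat :: G) (up e) (liftEnv s).
Proof.
  intros (W & He & Hs); assert (W' : wfCtx (tNat :: G)) by (econstructor; eauto using nat_type).
  split; [exact W'|]; split; [exact (envTyped_up _ _ _ W' He)
                             | exact (envTyped_lift _ _ _ _ W' Hs)].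
Qed.

Lemma env_up2 G e s : env G e s -> env (tFun :: G) (liftEnv e) (up s).
Proof.
  intros (W & He & Hs); assert (W' : wfCtx (tFun :: G)) by (econstructor; eauto using fun_type).
  split; [exact W'|]; split; [exact (envTyped_lift _ _ _ _ W' He)
                             | exact (envTyped_up _ _ _ W' Hs)].
Qed.

(** Set quantifiers stay in [U 0] because they range over [tFun], a type of [U 0]; quantifying over
    families of propositions would raise the level. *)
Lemma ifm_type p G e s : env G e s -> hasType G (ifm e s p) (U 0).
Proof.
  revert G e s; induction p; intros G e s H; pose proof H as (W & He & Hs); simpl;
    auto using imp_type, or_type, prod_type, ex_type, fun_type, nat_type, env_up1, env_up2.
  - apply eq_type; auto using nat_type, itm_type.
  - apply eq_type; auto using nat_type; [|exact (succ_type _ _ W (zero_type _ W))].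
    exact (ty_App _ _ _ _ _ (Hs X) (itm_type _ _ t W He)).
  - exact (ty_Cst _ cEmpty 0 0 W).
  - apply ty_Pi; auto using nat_type, env_up1.
  - apply ty_Pi; auto using fun_type, env_up2.
Qed.

(** * Derived rules *)

Lemma inh_conv G A B i : inh G A -> hasType G B (U i) -> conv A B -> inh G B.
Proof. intros [t H] HB C; exists t; exact (ty_conv _ _ _ _ _ H HB C). Qed.

Lemma inh_lift G A B i : hasType G A (U i) -> wfCtx G -> inh G B -> inh (A :: G) (lift B).
Proof.
  intros HA W [t H]; exists (lift t).
  exact (hasType_lift _ _ _ _ (wf_cons _ _ _ W HA) H).
Qed.

Lemma inh_pi G A B : hasType G A (U 0) -> inh (A :: G) B -> inh G (Pi A B).
Proof. intros HA [t H]; exists (Lam t); exact (ty_Lam _ _ _ _ _ HA H). Qed.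

Lemma inh_app G A B a : inh G (Pi A B) -> hasType G a A -> inh G (subst1 a B).
Proof. intros [t H] Ha; exists (App t a); exact (ty_App _ _ _ _ _ H Ha). Qed.

Lemma conv_tIsProp A B : conv A B -> conv (tIsProp A) (tIsProp B).
Proof.
  intros C; apply conv_Pi, conv_Pi; [exact C | apply conv_ren, C |].
  repeat apply conv_App; try apply conv_refl; apply conv_ren, conv_ren, C.
Qed.

Lemma conv_tImp A A' B B' : conv A A' -> conv B B' -> conv (tImp A B) (tImp A' B').
Proof. intros CA CB; apply conv_Pi; [exact CA | apply conv_ren, CB]. Qed.

Lemma conv_tProd A A' B B' : conv A A' -> conv B B' -> conv (tProd A B) (tProd A' B').
Proof.
  intros CA CB; repeat apply conv_App; try apply conv_refl; [exact CA|].
  apply conv_Lam, conv_ren, CB.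
Qed.

Lemma fam_type G A B :
  hasType G A (U 0) -> hasType (A :: G) B (U 0) -> hasType G (Lam B) (Pi A (U 0)).
Proof. intros HA HB; exact (ty_Lam _ _ _ _ _ HA HB). Qed.

Lemma fam_app_type G A B a :
  hasType G A (U 0) -> hasType (A :: G) B (U 0) -> hasType G a A ->
  hasType G (App (Lam B) a) (U 0).
Proof. intros HA HB; exact (ty_App _ _ _ _ _ (fam_type _ _ _ HA HB)). Qed.

(** A closed lemma takes a family as a function; under its binder the family appears as this
    redex. *)
Lemma beta_lift B : conv (App (lift (Lam B)) (Var 0)) B.
Proof.
  assert (E : subst1 (Var 0) (ren (scons 0 (fun n => S (S n))) B) = B).
  { unfold subst1; rewrite subst_ren, <- (subst_Var B) at 1; rewrite subst_subst.
    rewrite <- (subst_Var B) at 2; apply subst_ext; intros [|n]; reflexivity. }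
  rewrite <- E at 2; apply conv_comp, comp_beta.
Qed.

Lemma fam_lift_type G A B :
  wfCtx G -> hasType G A (U 0) -> hasType (A :: G) B (U 0) ->
  hasType (A :: G) (App (lift (Lam B)) (Var 0)) (U 0).
Proof.
  intros W HA HB; assert (W' : wfCtx (A :: G)) by (econstructor; eauto).
  exact (ty_App _ _ _ _ _ (hasType_lift _ _ _ _ W' (fam_type _ _ _ HA HB))
                          (ty_Var _ 0 _ W' eq_refl)).
Qed.

Lemma subst_tIsProp s A : subst s (tIsProp A) = tIsProp (subst s A).
Proof. unfold tIsProp; simpl; rewrite !subst_lift; reflexivity. Qed.

(** Feeds a typed argument to an instance of a closed lemma; the final type matches the goal by
    computation. *)
Local Notation "H ⊙ a" := (inh_inst _ _ _ _ _ H a)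
  (at level 11, left associativity).

Lemma inh_isProp_prod G A B :
  wfCtx G -> hasType G A (U 0) -> hasType G B (U 0) ->
  inh G (tIsProp A) -> inh G (tIsProp B) -> inh G (tIsProp (tProd A B)).
Proof.
  intros W HA HB [h Hh] [k Hk].
  (* The variables 3 and 2 of the closed statement are [A] and [B]. The goal takes this form because
     [subst] and [lift] commute under the binder of the product by a proved equation, not by
     computation. *)
  change (tProd A B) with
    (subst (scons k (scons h (scons B (scons A Var)))) (tProd (Var 3) (Var 2))).
  rewrite <- subst_tIsProp; exact (inh_closed G _ isProp_prod W ⊙ HA ⊙ HB ⊙ Hh ⊙ Hk).
Qed.

Lemma inh_isProp_trunc G A :
  wfCtx G -> hasType G A (U 0) -> inh G (tIsProp (App (Cst cTrunc) A)).
Proof. intros W HA; exact (inh_closed G _ isProp_trunc W ⊙ HA). Qed.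

Lemma inh_isProp_eq_nat G a b :
  wfCtx G -> hasType G a tNat -> hasType G b tNat -> inh G (tIsProp (tEq tNat a b)).
Proof.
  intros W Ha Hb; exact (inh_closed G _ isSet_nat W ⊙ Ha ⊙ Hb).
Qed.

(** The closed lemma speaks of the family [Lam B]; its premise and its conclusion are carried across
    beta conversion. *)
Lemma inh_isProp_pi G A B :
  wfCtx G -> hasType G A (U 0) -> hasType (A :: G) B (U 0) ->
  inh (A :: G) (tIsProp B) -> inh G (tIsProp (Pi A B)).
Proof.
  intros W HA HB HP.
  assert (W' : wfCtx (A :: G)) by (econstructor; eauto).
  pose proof (fam_lift_type _ _ _ W HA HB) as HR.
  assert (HP' : inh G (Pi A (tIsProp (App (lift (Lam B)) (Var 0))))).
  { apply inh_pi; [exact HA|].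
    eapply inh_conv; [exact HP | exact (isProp_type _ _ W' HR) |].
    apply conv_tIsProp, conv_sym, beta_lift. }
  destruct HP' as [h Hh].
  eapply inh_conv; [|exact (isProp_type _ _ W (ty_Pi _ _ _ _ HA HB)) |
    apply conv_tIsProp, (conv_Pi A A _ B (conv_refl A) (beta_lift B))].
  change (Pi A (App (lift (Lam B)) (Var 0))) with
    (subst (scons h (scons (Lam B) (scons A Var))) (Pi (Var 2) (App (Var 2) (Var 0)))).
  rewrite <- subst_tIsProp; exact (inh_closed G _ isProp_pi W ⊙ HA ⊙ fam_type _ _ _ HA HB ⊙ Hh).
Qed.

(** Equations fall under [isSet_nat], disjunction and existence are truncations, and implication and
    the universal quantifiers are products of propositions. *)
Lemma ifm_isProp p G e s : env G e s -> inh G (tIsProp (ifm e s p)).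
Proof.
  revert G e s; induction p; intros G e s H; pose proof H as (W & He & Hs); simpl.
  - apply inh_isProp_eq_nat; auto using itm_type.
  - apply inh_isProp_eq_nat; [exact W | | exact (succ_type _ _ W (zero_type _ W))].
    exact (ty_App _ _ _ _ _ (Hs X) (itm_type _ _ t W He)).
  - exact (inh_closed G _ isProp_empty W).
  - apply inh_isProp_prod; auto using ifm_type.
  - exact (inh_isProp_trunc _ _ W
      (hasType_inst _ _ _ _ _ _ (hasType_inst _ _ _ _ _ _ (hasType_cst G cSum 0 0 W)
        (ifm_type p1 _ _ _ H)) (ifm_type p2 _ _ _ H))).
  - pose proof (ifm_type p1 _ _ _ H) as H1.
    unfold tImp; rewrite <- lift_ifm; pose proof (env_lift _ _ _ _ _ H H1) as H'.
    apply inh_isProp_pi; auto using ifm_type.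
  - apply inh_isProp_pi; auto using nat_type, ifm_type, env_up1.
  - apply inh_isProp_trunc, sig_type; auto using nat_type.
    apply fam_type; auto using nat_type, ifm_type, env_up1.
  - apply inh_isProp_pi; auto using fun_type, ifm_type, env_up2.
  - apply inh_isProp_trunc, sig_type; auto using fun_type.
    apply fam_type; auto using fun_type, ifm_type, env_up2.
Qed.

Lemma inh_ex_intro G A B a :
  wfCtx G -> hasType G A (U 0) -> hasType (A :: G) B (U 0) -> hasType G a A ->
  inh G (subst1 a B) -> inh G (tEx A B).
Proof.
  intros W HA HB Ha Hb.
  eapply inh_conv in Hb;
    [|exact (fam_app_type _ _ _ _ HA HB Ha) | apply conv_sym, conv_comp, comp_beta].
  destruct Hb as [b Hb].
  exact (inh_closed G _ exists_intro W ⊙ HA ⊙ fam_type _ _ _ HA HB ⊙ Ha ⊙ Hb).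
Qed.

Lemma inh_ex_elim G A B C :
  wfCtx G -> hasType G A (U 0) -> hasType (A :: G) B (U 0) -> hasType G C (U 0) ->
  inh G (tIsProp C) -> inh G (tEx A B) -> inh (B :: A :: G) (lift (lift C)) -> inh G C.
Proof.
  intros W HA HB HC [h Hh] [x Hx] HBC.
  assert (W' : wfCtx (A :: G)) by (econstructor; eauto).
  pose proof (hasType_lift _ _ _ _ W' HC) as HC'.
  assert (HR := imp_type _ _ _ W' (fam_lift_type _ _ _ W HA HB) HC').
  assert (Hf : inh G (Pi A (tImp (App (lift (Lam B)) (Var 0)) (lift C)))).
  { apply inh_pi; [exact HA|].
    eapply inh_conv; [exact (inh_pi _ _ _ HB HBC) | exact HR |].
    apply conv_tImp; [apply conv_sym, beta_lift | apply conv_refl]. }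
  destruct Hf as [f Hf].
  exact (inh_closed G _ exists_elim W ⊙ HA ⊙ fam_type _ _ _ HA HB ⊙ HC ⊙ Hh ⊙ Hx ⊙ Hf).
Qed.

Lemma inh_or_elim G A B C :
  wfCtx G -> hasType G A (U 0) -> hasType G B (U 0) -> hasType G C (U 0) ->
  inh G (tIsProp C) -> inh G (tOr A B) -> inh G (tImp A C) -> inh G (tImp B C) -> inh G C.
Proof.
  intros W HA HB HC [h Hh] [x Hx] [f Hf] [g Hg].
  exact (inh_closed G _ or_elim W ⊙ HA ⊙ HB ⊙ HC ⊙ Hh ⊙ Hx ⊙ Hf ⊙ Hg).
Qed.

Lemma inh_reductio G A :
  wfCtx G -> hasType G A (U 0) -> inh G (tIsProp A) ->
  inh G (tImp (tImp A (Cst cEmpty)) (Cst cEmpty)) -> inh G A.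
Proof.
  intros W HA [h Hh] [k Hk].
  exact (inh_closed G _ reductio W ⊙ HA ⊙ Hh ⊙ Hk).
Qed.

Lemma inh_transport G B m n :
  wfCtx G -> hasType (tNat :: G) B (U 0) -> hasType G m tNat -> hasType G n tNat ->
  hasType G (subst1 n B) (U 0) ->
  inh G (tEq tNat m n) -> inh G (subst1 m B) -> inh G (subst1 n B).
Proof.
  intros W HB Hm Hn HBn [p Hp] Hb; pose proof (nat_type _ W) as HN.
  eapply inh_conv in Hb;
    [|exact (fam_app_type _ _ _ _ HN HB Hm) | apply conv_sym, conv_comp, comp_beta].
  destruct Hb as [b Hb].
  eapply inh_conv; [|exact HBn | apply conv_comp, comp_beta].
  exact (inh_closed G _ transport_nat W ⊙ fam_type _ _ _ HN HB ⊙ Hm ⊙ Hn ⊙ Hp ⊙ Hb).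
Qed.

(** [R] is the predicate under the binders of the new set and of the number, left as a redex because
    the closed statement delivers it so. *)
Lemma inh_comprehension G B :
  wfCtx G -> hasType (tNat :: G) B (U 0) -> inh (tNat :: G) (tIsProp B) ->
  let R := App (lift (lift (Lam B))) (Var 0) in
  inh G (tEx tFun (Pi tNat (tProd (tImp (tEq tNat (App (Var 1) (Var 0)) tOne) R)
                                  (tImp R (tEq tNat (App (Var 1) (Var 0)) tOne))))).
Proof.
  intros W HB HP; pose proof (nat_type _ W) as HN.
  assert (W' : wfCtx (tNat :: G)) by (econstructor; eauto).
  assert (HP' : inh G (Pi tNat (tIsProp (App (lift (Lam B)) (Var 0))))).
  { apply inh_pi; [exact HN|].
    eapply inh_conv; [exact HP | exact (isProp_type _ _ W' (fam_lift_type _ _ _ W HN HB)) |].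
    apply conv_tIsProp, conv_sym, beta_lift. }
  destruct HP' as [h Hh].
  exact (inh_closed G _ comprehension W ⊙ fam_type _ _ _ HN HB ⊙ Hh).
Qed.

(** * Formula substitution inside the interpretation *)

Lemma ifm_shift1 e s p :
  ifm (up e) (liftEnv s) (shift1 p) = lift (ifm e s p).
Proof. unfold shift1; rewrite ifm_fsub, <- lift_ifm; reflexivity. Qed.

Lemma ifm_shift2 e s p :
  ifm (liftEnv e) (up s) (shift2 p) = lift (ifm e s p).
Proof. unfold shift2; rewrite ifm_fsub, <- lift_ifm; reflexivity. Qed.

Lemma ifm_inst1 e s t p :
  ifm e s (inst1 t p) = subst1 (itm e t) (ifm (up e) (liftEnv s) p).
Proof.
  unfold inst1, subst1; rewrite ifm_fsub, subst_ifm; apply ifm_ext.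
  - intros [|n]; [reflexivity | symmetry; apply subst1_lift].
  - intros n; symmetry; apply subst1_lift.
Qed.

Lemma ifm_inst2 e s X p :
  ifm e s (inst2 X p) = subst1 (s X) (ifm (liftEnv e) (up s) p).
Proof.
  unfold inst2, subst1; rewrite ifm_fsub, subst_ifm; apply ifm_ext.
  - intros n; symmetry; apply subst1_lift.
  - intros [|n]; [reflexivity | symmetry; apply subst1_lift].
Qed.

(** * Soundness *)

Definition hyps (G : ctx) (e s : nat -> term) (H : list form) : Prop :=
  forall q, In q H -> inh G (ifm e s q).

Lemma hyps_lift G A e s H :
  env G e s -> hasType G A (U 0) -> hyps G e s H -> hyps (A :: G) (liftEnv e) (liftEnv s) H.
Proof.
  intros (W & _) HA HH q Hq; rewrite lift_ifm; eapply inh_lift; eauto.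
Qed.

Lemma hyps_assume G e s p H :
  env G e s -> hyps G e s H ->
  hyps (ifm e s p :: G) (liftEnv e) (liftEnv s) (p :: H).
Proof.
  intros HE HH q [<-|Hq]; [|exact (hyps_lift _ _ _ _ _ HE (ifm_type p _ _ _ HE) HH q Hq)].
  exists (Var 0); rewrite lift_ifm; apply (ty_Var _ 0); [|reflexivity].
  exact (wf_cons _ _ _ (proj1 HE) (ifm_type p _ _ _ HE)).
Qed.

Lemma hyps_shift1 G e s H :
  env G e s -> hyps G e s H -> hyps (tNat :: G) (up e) (liftEnv s) (map shift1 H).
Proof.
  intros (W & _) HH q Hq; apply in_map_iff in Hq as (r & <- & Hr).
  rewrite ifm_shift1; eapply inh_lift; eauto using nat_type.
Qed.

Lemma hyps_shift2 G e s H :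
  env G e s -> hyps G e s H -> hyps (tFun :: G) (liftEnv e) (up s) (map shift2 H).
Proof.
  intros (W & _) HH q Hq; apply in_map_iff in Hq as (r & <- & Hr).
  rewrite ifm_shift2; eapply inh_lift; eauto using fun_type.
Qed.

(** Quantifying over contexts lets the induction enter binders: an assumption or an eigenvariable
    extends the context. *)
Definition valid (H : list form) (p : form) : Prop :=
  forall G e s, env G e s -> hyps G e s H -> inh G (ifm e s p).

Lemma valid_assume H p q G e s :
  valid (p :: H) q -> env G e s -> hyps G e s H ->
  inh (ifm e s p :: G) (lift (ifm e s q)).
Proof.
  intros V HE HH; rewrite <- lift_ifm; apply V; [|apply hyps_assume; assumption].
  exact (env_lift _ _ _ _ _ HE (ifm_type p _ _ _ HE)).
Qed.

Lemma valid_imp H p q G e s :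
  valid (p :: H) q -> env G e s -> hyps G e s H ->
  inh G (tImp (ifm e s p) (ifm e s q)).
Proof. intros V HE HH; apply inh_pi; eauto using ifm_type, valid_assume. Qed.

Lemma axiom_closed_inh p t :
  proves t (interpForm (fun _ => bcst cZero) (fun _ => blam (fun _ => bcst cZero)) p) = true ->
  forall G, wfCtx G -> inh G (subst Var (interp p)).
Proof. intros E G; exact (inh_closed G _ (proves_inh _ _ E)). Qed.

(** The axiom is a concrete sentence, whose interpretation computes to the same type in every
    environment, so one closed check serves all. *)
Ltac by_proof t :=
  match goal with |- valid [] ?p =>
    assert (E : forall G, wfCtx G -> inh G (subst Var (interp p)))
      by (apply (axiom_closed_inh p t); vm_compute; reflexivity);
    intros G e s HE _; exact (E G (proj1 HE))
  end.

Lemma axiom_valid p : PA2axiom p -> valid [] p.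
Proof.
  intros [].
  - intros G e s HE _; exact (inh_closed G _ succ_nonzero (proj1 HE)).
  - intros G e s HE _; exact (inh_closed G _ succ_inj (proj1 HE)).
  (* Addition and multiplication recurse on the second argument, so their defining equations hold by
     computation. *)
  - by_proof (λ n, cRefl · cNat · n)%B.
  - by_proof (λ m, λ n, cRefl · cNat · (cSucc · badd m n))%B.
  - by_proof (λ n, cRefl · cNat · cZero)%B.
  - by_proof (λ m, λ n, cRefl · cNat · badd (bmul m n) m)%B.
  (* Second-order induction is [cIndNat] at the motive of membership in [f]. *)
  - by_proof (λ f, λ h,
      let holds n := cId · cNat · (f · n) · (cSucc · cZero) in
      let A := holds cZero in
      let B := Π n : cNat, holds n ⇒ holds (cSucc · n) in
      λ n, cIndNat · (λ n, holds n) · bfst A B h · bsnd A B h · n)%B.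
  - intros G e s HE _; pose proof HE as (W & _).
    pose proof (ifm_type p0 _ _ _ (env_up1 _ _ _ HE)) as HB.
    eapply inh_conv.
    + exact (inh_comprehension _ _ W HB (ifm_isProp p0 _ _ _ (env_up1 _ _ _ HE))).
    + exact (ifm_type (FEx2 (FAll1 (FIff (FMem (TVar 0) 0) (shift2 p0)))) _ _ _ HE).
    (* The redex reduces to the interpretation of [shift2 p0], which passes over the new set
       variable. *)
    + assert (C : conv (App (lift (lift (Lam (ifm (up e) (liftEnv s) p0)))) (Var 0))
                       (ifm (up (liftEnv e)) (liftEnv (up s)) (shift2 p0))).
      { eapply conv_trans; [apply conv_comp, comp_beta|].
        (* Outer values do not mention the element of the predicate, so substituting variable 0 only
           removes one [lift]. *)
        assert (Hr : forall t, subst1 (Var 0) (ren (scons 0 (fun n => S (S n)))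
                   (ren (scons 0 (fun n => S (S n))) (lift t))) = lift (lift t)).
        { intros t; rewrite !(ren_lift S); apply subst1_lift. }
        match goal with |- conv ?t ?u => replace t with u; [apply conv_refl|] end.
        unfold shift2; rewrite ifm_fsub, !ren_ifm; unfold subst1; rewrite subst_ifm.
        symmetry; apply ifm_ext; intros n; [destruct n; [reflexivity|]|]; apply Hr. }
      (* The two types differ only in the two occurrences of the predicate, reached by
         congruence. *)
      apply conv_App; [apply conv_refl|].
      apply conv_App; [apply conv_refl|].
      apply conv_Lam, conv_Pi; [apply conv_refl|].
      apply conv_tProd; apply conv_tImp; auto using conv_refl.
Qed.

Theorem soundness H p : PA2derives H p -> valid H p.
Proof.
  induction 1; intros G e s HE HH; pose proof HE as (W & He & Hs).
  - apply axiom_valid; [assumption | assumption | intros q []].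
  - apply HH; assumption.
  - apply inh_reductio; auto using ifm_type, ifm_isProp.
    exact (valid_imp _ _ _ _ _ _ IHPA2derives HE HH).
  - exact (valid_imp _ _ _ _ _ _ IHPA2derives HE HH).
  - destruct (IHPA2derives2 _ _ _ HE HH) as [t Ht].
    (* An implication is a product over a constant family, so substituting the proof [t] changes
       nothing. *)
    rewrite <- (subst1_lift t (ifm e s q)).
    exact (inh_app _ _ _ _ (IHPA2derives1 _ _ _ HE HH) Ht).
  - destruct (IHPA2derives1 _ _ _ HE HH) as [t Ht], (IHPA2derives2 _ _ _ HE HH) as [u Hu].
    exact (inh_closed G _ prod_intro W ⊙ ifm_type p _ _ _ HE ⊙ ifm_type q _ _ _ HE ⊙ Ht ⊙ Hu).
  - destruct (IHPA2derives _ _ _ HE HH) as [t Ht].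
    exact (inh_closed G _ prod_fst W ⊙ ifm_type p _ _ _ HE ⊙ ifm_type q _ _ _ HE ⊙ Ht).
  - destruct (IHPA2derives _ _ _ HE HH) as [t Ht].
    exact (inh_closed G _ prod_snd W ⊙ ifm_type p _ _ _ HE ⊙ ifm_type q _ _ _ HE ⊙ Ht).
  - destruct (IHPA2derives _ _ _ HE HH) as [t Ht].
    exact (inh_closed G _ or_introl W ⊙ ifm_type p _ _ _ HE ⊙ ifm_type q _ _ _ HE ⊙ Ht).
  - destruct (IHPA2derives _ _ _ HE HH) as [t Ht].
    exact (inh_closed G _ or_intror W ⊙ ifm_type p _ _ _ HE ⊙ ifm_type q _ _ _ HE ⊙ Ht).
  - apply (inh_or_elim G (ifm e s p) (ifm e s q)); auto using ifm_type, ifm_isProp.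
    + exact (IHPA2derives1 _ _ _ HE HH).
    + exact (valid_imp _ _ _ _ _ _ IHPA2derives2 HE HH).
    + exact (valid_imp _ _ _ _ _ _ IHPA2derives3 HE HH).
  - apply inh_pi; [apply nat_type, W|].
    apply IHPA2derives; auto using env_up1, hyps_shift1.
  - rewrite ifm_inst1.
    exact (inh_app _ _ _ _ (IHPA2derives _ _ _ HE HH) (itm_type _ _ t W He)).
  - pose proof (IHPA2derives _ _ _ HE HH) as HI; rewrite ifm_inst1 in HI.
    refine (inh_ex_intro _ _ _ _ W _ _ (itm_type _ _ t W He) HI);
      auto using nat_type, ifm_type, env_up1.
  - pose proof (env_up1 _ _ _ HE) as HE'.
    refine (inh_ex_elim _ _ _ _ W _ _ _ _ (IHPA2derives1 _ _ _ HE HH) _);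
      auto using nat_type, ifm_type, ifm_isProp.
    (* The eigenvariable condition, expressed by [shift1 q], becomes independence of the goal from
       the witness. *)
    rewrite <- ifm_shift1.
    exact (valid_assume _ _ _ _ _ _ IHPA2derives2 HE' (hyps_shift1 _ _ _ _ HE HH)).
  - apply inh_pi; [apply fun_type, W|].
    apply IHPA2derives; auto using env_up2, hyps_shift2.
  - rewrite ifm_inst2; exact (inh_app _ _ _ _ (IHPA2derives _ _ _ HE HH) (Hs X)).
  - pose proof (IHPA2derives _ _ _ HE HH) as HI; rewrite ifm_inst2 in HI.
    refine (inh_ex_intro _ _ _ _ W _ _ (Hs X) HI);
      auto using fun_type, ifm_type, env_up2.
  - pose proof (env_up2 _ _ _ HE) as HE'.
    refine (inh_ex_elim _ _ _ _ W _ _ _ _ (IHPA2derives1 _ _ _ HE HH) _);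
      auto using fun_type, ifm_type, ifm_isProp.
    rewrite <- ifm_shift2.
    exact (valid_assume _ _ _ _ _ _ IHPA2derives2 HE' (hyps_shift2 _ _ _ _ HE HH)).
  - exact (inh_closed G _ eq_refl_nat W ⊙ itm_type _ _ t W He).
  - pose proof (IHPA2derives2 _ _ _ HE HH) as HI; rewrite ifm_inst1 in *.
    refine (inh_transport _ _ _ _ W _ (itm_type _ _ t W He) (itm_type _ _ u W He) _
              (IHPA2derives1 _ _ _ HE HH) HI);
      [|rewrite <- ifm_inst1]; auto using ifm_type, env_up1.
Qed.

Lemma env_empty : env [] (fun _ => tZero) (fun _ => Lam tZero).
Proof.
  pose proof wf_nil as W; split; [exact W|]; split; intros n; [exact (zero_type _ W)|].
  eapply ty_Lam; [exact (nat_type _ W)|].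
  exact (zero_type _ (wf_cons _ _ _ W (nat_type _ W))).
Qed.

Theorem corollary5p6 :
  forall p : form,
    sentence p ->
    hasType [] (interp p) (U 0) /\
    (exists h : term, hasType [] h (isProp (interp p))) /\
    (PA2derives [] p -> exists t : term, hasType [] t (interp p)).
Proof.
  intros p _; rewrite isProp_tIsProp, interp_ifm; pose proof env_empty as HE.
  split; [apply ifm_type, HE | split; [apply (ifm_isProp p _ _ _ HE)|]].
  intros D; apply (soundness _ _ D _ _ _ HE); intros q [].
Qed.
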